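(* Let $m,k$ be real constants with $k\geq m\geq 2$, and let $\gamma_1,\gamma_2,\gamma_3>0$ be real numbers such that either $$\gamma_1-\gamma_2-m^2\gamma_3-3m(k-1)\gamma_3-e(e+1)\geq \sqrt{2}\,e$$ or $$1-e-e\big(\gamma_1+\gamma_2+m^2\gamma_3+3m(k-1)\gamma_3\big)\geq \sqrt{2}.$$ If $p$ is an analytic function in $\mathbb{D}$ such that $p(0)=1$ and $$p(z)+\gamma_1 zp'(z)+\gamma_2 z^2p''(z)+\gamma_3 z^3p'''(z)\prec z+\sqrt{1+z^2},$$ then $p(z)\prec e^z$.
   Context: $\mathbb{D}=\{z\in\mathbb{C}:|z|<1\}$ is the open unit disk. The square root is the principal branch, so that $\sqrt{1+z^2}$ is analytic on $\mathbb{D}$ with value $1$ at $z=0$. For analytic functions $g,h$ on $\mathbb{D}$, $g\prec h$ ($g$ is subordinate to $h$) means that there is an analytic function $w:\mathbb{D}\to\mathbb{D}$ with $w(0)=0$ and $|w(z)|\le|z|$ such that $g(z)=h(w(z))$ for all $z\in\mathbb{D}$. *)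

(* Defs.v *)
From Stdlib Require Import Reals Lra.
From Coquelicot Require Import Coquelicot.

Open Scope R_scope.

Definition unit_disk (z : C) : Prop := Cmod z < 1.

(* Complex differentiability at every point of [U]; only meaningful for open
   [U].  Since the unit disk is open, the values of [f] off the disk are
   irrelevant there. *)
Definition analytic_on (U : C -> Prop) (f : C -> C) : Prop :=
  forall z : C, U z -> @ex_derive C_AbsRing C_NormedModule f z.

Definition subordinate (g h : C -> C) : Prop :=
  exists w : C -> C,
    analytic_on unit_disk w /\
    (forall z : C, unit_disk z -> unit_disk (w z)) /\
    w (RtoC 0) = RtoC 0 /\
    (forall z : C, unit_disk z -> Cmod (w z) <= Cmod z) /\
    (forall z : C, unit_disk z -> g z = h (w z)).

Definition Cexp (z : C) : C := (exp (Re z) * cos (Im z), exp (Re z) * sin (Im z)).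

(* Principal branch, in Cartesian form: the square root lying in the closed
   right half-plane, with nonnegative imaginary part on the imaginary axis
   (see the three lemmas below). *)
Definition Csqrt (z : C) : C :=
  (sqrt ((Cmod z + Re z) / 2),
   if Rle_dec 0 (Im z) then sqrt ((Cmod z - Re z) / 2)
   else - sqrt ((Cmod z - Re z) / 2)).

Lemma Csqrt_sqr (z : C) : (Csqrt z * Csqrt z)%C = z.
Proof.
  destruct z as [x y].
  assert (Hx := re_le_Cmod (x, y)); simpl in Hx.
  apply Rabs_le_between in Hx.
  assert (HM : Cmod (x, y) * Cmod (x, y) = x * x + y * y).
  { unfold Cmod; rewrite sqrt_sqrt; simpl; nra. }
  assert (Hprod : sqrt ((Cmod (x, y) + x) / 2) * sqrt ((Cmod (x, y) - x) / 2)
                  = Rabs y / 2).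
  { rewrite <- sqrt_mult by lra.
    replace ((Cmod (x, y) + x) / 2 * ((Cmod (x, y) - x) / 2))
      with (Rsqr (y / 2)) by (unfold Rsqr; nra).
    rewrite sqrt_Rsqr_abs; unfold Rdiv.
    rewrite Rabs_mult, (Rabs_pos_eq (/ 2)); lra. }
  assert (Ha := sqrt_sqrt ((Cmod (x, y) + x) / 2) ltac:(lra)).
  assert (Hb := sqrt_sqrt ((Cmod (x, y) - x) / 2) ltac:(lra)).
  unfold Csqrt, Cmult; simpl.
  destruct (Rle_dec 0 y) as [Hy | Hy].
  - rewrite Rabs_pos_eq in Hprod by lra.
    apply injective_projections; simpl; nra.
  - rewrite Rabs_left in Hprod by lra.
    apply injective_projections; simpl; nra.
Qed.

Lemma Csqrt_Re_ge_0 (z : C) : 0 <= Re (Csqrt z).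
Proof. apply sqrt_pos. Qed.

Lemma Csqrt_Im_ge_0 (z : C) : Re (Csqrt z) = 0 -> 0 <= Im (Csqrt z).
Proof.
  destruct z as [x y]; unfold Csqrt; simpl; intros H.
  destruct (Rle_dec 0 y) as [Hy | Hy]; [apply sqrt_pos | exfalso].
  assert (Hx := re_le_Cmod (x, y)); simpl in Hx.
  apply Rabs_le_between in Hx.
  apply sqrt_eq_0 in H; [| lra].
  assert (HM : Cmod (x, y) * Cmod (x, y) = x * x + y * y).
  { unfold Cmod; rewrite sqrt_sqrt; simpl; nra. }
  assert (Cmod (x, y) = - x) by lra.
  nra.
Qed.

(* Main.v *)
Require Import Defs.
From Stdlib Require Import Reals Lra Psatz Classical ClassicalEpsilon.
From Coquelicot Require Import Coquelicot.

Open Scope R_scope.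

(** The second alternative of the hypothesis cannot hold, since its left-hand
    side is negative.  The first one makes [gamma1] dominate the other terms of
    the differential operator, with the outcome that [|p'| <= 1 / 4] on the
    disk.  Then [|p z - 1| <= |z| / 4], so that [p] stays in the right
    half-plane and [w z = Clog (p z)] is a holomorphic function with
    [Cexp (w z) = p z] and [|w z| <= (3 / 4) |z|].

    The bound on [p'] ([gradient_bound]) is a maximum argument.  Let [f] denote
    [p + gamma1 z p' + gamma2 z^2 p'' + gamma3 z^3 p''']; the subordination
    implies [|f z - 1| <= 2 |z|] ([crescent_minus_1]).  Let [a] be a point of a
    closed disk around the origin at which [|G|] is maximal, where [G = p'], put
    [M = |G a|], and write [D] for the operator [z d/dz].  Maximality along the
    radius and along the circle through [a] gives, at [a],
    [Re (Cconj G * D G) >= 0] and [|D G|^2 <= Re (Cconj G * D (D G))]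
    ([max_modulus_conditions]).  Since [z G' = D G] and
    [z^2 G'' = D (D G) - D G], the sum [S = gamma1 G + gamma2 z G' + gamma3 z^2 G'']
    satisfies [Re (Cconj G * S) >= (gamma1 - gamma3 / 4) M^2 >= 9 M^2] at [a].
    But [z S = f - p] is at most [|f - 1| + |p - 1| <= (2 + M) |z|] in modulus, so
    that [|S| <= 2 + M], by continuity also at the centre.  Hence
    [9 M <= 2 + M].

    Analyticity means only that [p] is complex differentiable at each point of
    the disk, so the existence of the higher derivatives has to be established
    ([Cdiff_derivative_again]).  Goursat's theorem on rectangles, read in
    logarithmic coordinates, says that the mean of a holomorphic function over
    the circle of radius [r] does not depend on [r] in an annulus
    ([circle_int_constant]).  As the mean is continuous in [r], this remains true
    across a circle that contains points of mere continuity, and so it applies to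
    [w (f w - f z) / (w - z)].  The result is Cauchy's formula
    ([Cauchy_formula]), which is differentiated twice under the integral sign. *)

(** * Complex differentiability and the exponential *)

(** The plane with the uniformity of the absolute value [Cmod] instead of the
    product one, so that results about absolute-valued rings apply to it. *)
Notation CU := (AbsRing_UniformSpace C_AbsRing).

Definition Cdiff (f : C -> C) (z l : C) : Prop :=
  @is_derive C_AbsRing (AbsRing_NormedModule C_AbsRing) f z l.

Definition Ccont (f : C -> C) (z : C) : Prop := @continuous CU CU f z.

Lemma Cmod_minus_sym (x y : C) : Cmod (x - y) = Cmod (y - x).
Proof. rewrite <- Cmod_opp; f_equal; ring. Qed.

Lemma Cmod_minus_ge (x y : C) : Cmod x - Cmod y <= Cmod (x - y).
Proof.
  assert (H := Cmod_triangle (x - y) y).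
  replace (x - y + y)%C with x in H by ring; lra.
Qed.

Lemma im_le_Cmod (z : C) : Rabs (Im z) <= Cmod z.
Proof. eapply Rle_trans; [apply Rmax_r | apply Rmax_Cmod]. Qed.

Lemma Cmod_le_Re_Im (z : C) : Cmod z <= Rabs (Re z) + Rabs (Im z).
Proof.
  assert (H := Cmod2_alt z); assert (H0 := Cmod_ge_0 z).
  assert (H1 := Rabs_pos (Re z)); assert (H2 := Rabs_pos (Im z)).
  rewrite <- (pow2_abs (Re z)), <- (pow2_abs (Im z)) in H; nra.
Qed.

Lemma Cmod_Cexp (z : C) : Cmod (Cexp z) = exp (Re z).
Proof.
  assert (H := Cmod2_alt (Cexp z)); assert (H0 := Cmod_ge_0 (Cexp z)).
  assert (H1 := exp_pos (Re z)); unfold Cexp in *; simpl in *.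
  assert (H2 := sin2_cos2 (Im z)); unfold Rsqr in H2.
  assert (exp (Re z) * exp (Re z) * (sin (Im z) * sin (Im z) + cos (Im z) * cos (Im z))
    = exp (Re z) * exp (Re z)) by (rewrite H2; ring).
  nra.
Qed.

Lemma Cexp_plus (a b : C) : Cexp (a + b) = (Cexp a * Cexp b)%C.
Proof.
  unfold Cexp, Re, Im; apply injective_projections; simpl;
    rewrite exp_plus, ?cos_plus, ?sin_plus; ring.
Qed.

Lemma Cexp_0 : Cexp 0 = 1.
Proof.
  unfold Cexp, RtoC; simpl; rewrite exp_0, cos_0, sin_0.
  apply injective_projections; simpl; ring.
Qed.

Lemma Ccont_eps (f : C -> C) (z : C) :
  Ccont f z <->
  forall eps, 0 < eps -> exists d, 0 < d /\
    forall w, Cmod (w - z) < d -> Cmod (f w - f z) < eps.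
Proof.
  split.
  - intros H eps He.
    apply filterlim_locally with (eps := mkposreal eps He) in H.
    destruct H as [d Hd]; exists d; split; [apply cond_pos | exact Hd].
  - intros H; apply filterlim_locally; intros eps.
    destruct (H eps (cond_pos eps)) as [d [Hd Hf]].
    exists (mkposreal d Hd); exact Hf.
Qed.

Lemma Cdiff_eps (f : C -> C) (z l : C) :
  Cdiff f z l <->
  forall eps, 0 < eps -> exists d, 0 < d /\
    forall w, Cmod (w - z) < d ->
      Cmod (f w - f z - l * (w - z)) <= eps * Cmod (w - z).
Proof.
  assert (E : forall w, (l * (w - z) = (w - z) * l)%C) by (intros; ring).
  split.
  - intros [_ H] eps He.
    destruct (H z (fun P HP => HP) (mkposreal eps He)) as [d Hd].
    exists d; split; [apply cond_pos |]; intros w Hw.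
    rewrite E; exact (Hd w Hw).
  - intros H; split; [apply is_linear_scal_l |].
    intros x Hx.
    apply (@is_filter_lim_locally_unique C_AbsRing (AbsRing_NormedModule C_AbsRing)) in Hx.
    subst x.
    intros eps; destruct (H eps (cond_pos eps)) as [d [Hd Hf]].
    exists (mkposreal d Hd); intros w Hw; specialize (Hf w Hw).
    rewrite E in Hf; exact Hf.
Qed.

(** Both sides unfold to the same estimate; only the uniformity carried by the
    target type differs. *)
Lemma is_derive_Cdiff (f : C -> C) (z l : C) :
  @is_derive C_AbsRing C_NormedModule f z l <-> Cdiff f z l.
Proof.
  rewrite Cdiff_eps.
  assert (E : forall w, (l * (w - z) = (w - z) * l)%C) by (intros; ring).
  split.
  - intros [_ H] eps He.
    destruct (H z (fun P HP => HP) (mkposreal eps He)) as [d Hd].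
    exists d; split; [apply cond_pos |]; intros w Hw.
    rewrite E; exact (Hd w Hw).
  - intros H; split; [apply is_linear_scal_l |].
    intros x Hx.
    apply (@is_filter_lim_locally_unique C_AbsRing (AbsRing_NormedModule C_AbsRing)) in Hx.
    subst x.
    intros eps; destruct (H eps (cond_pos eps)) as [d [Hd Hf]].
    exists (mkposreal d Hd); intros w Hw; specialize (Hf w Hw).
    rewrite E in Hf; exact Hf.
Qed.

Lemma Cdiff_const (c z : C) : Cdiff (fun _ => c) z 0.
Proof. exact (@is_derive_const C_AbsRing (AbsRing_NormedModule C_AbsRing) c z). Qed.

Lemma Cdiff_id (z : C) : Cdiff (fun w => w) z 1.
Proof. exact (@is_derive_id C_AbsRing z). Qed.

Lemma Cdiff_plus (f g : C -> C) (z a b : C) :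
  Cdiff f z a -> Cdiff g z b -> Cdiff (fun w => f w + g w)%C z (a + b)%C.
Proof. exact (@is_derive_plus C_AbsRing (AbsRing_NormedModule C_AbsRing) f g z a b). Qed.

Lemma Cdiff_minus (f g : C -> C) (z a b : C) :
  Cdiff f z a -> Cdiff g z b -> Cdiff (fun w => f w - g w)%C z (a - b)%C.
Proof. exact (@is_derive_minus C_AbsRing (AbsRing_NormedModule C_AbsRing) f g z a b). Qed.

Lemma Cdiff_mult (f g : C -> C) (z a b : C) :
  Cdiff f z a -> Cdiff g z b ->
  Cdiff (fun w => f w * g w)%C z (a * g z + f z * b)%C.
Proof.
  intros Hf Hg.
  exact (@is_derive_mult C_AbsRing f g z a b Hf Hg Cmult_comm).
Qed.

Lemma Cdiff_comp (f g : C -> C) (z a b : C) :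
  Cdiff f (g z) a -> Cdiff g z b -> Cdiff (fun w => f (g w)) z (b * a)%C.
Proof. exact (@is_derive_comp C_AbsRing (AbsRing_NormedModule C_AbsRing) f g z a b). Qed.

Lemma Cdiff_ext_loc (f g : C -> C) (z l : C) (r : R) :
  0 < r -> (forall w, Cmod (w - z) < r -> f w = g w) ->
  Cdiff f z l -> Cdiff g z l.
Proof.
  intros Hr E.
  apply (@is_derive_ext_loc C_AbsRing (AbsRing_NormedModule C_AbsRing) f g z l).
  exists (mkposreal r Hr); exact E.
Qed.

Lemma Cdiff_Ccont (f : C -> C) (z l : C) : Cdiff f z l -> Ccont f z.
Proof.
  intros H.
  exact (@ex_derive_continuous C_AbsRing (AbsRing_NormedModule C_AbsRing) f z (ex_intro _ l H)).
Qed.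

Lemma Cdiff_inv (f : C -> C) (z l : C) : f z <> 0 ->
  Cdiff f z l -> Cdiff (fun w => / f w)%C z (- l / (f z * f z))%C.
Proof.
  intros H0 H.
  assert (I : Cdiff (fun w => / w)%C (f z) (- / (f z * f z))%C).
  { set (a := f z) in *; clearbody a; clear f H l.
    assert (Ha : 0 < Cmod a) by (apply Cmod_gt_0; exact H0).
    apply Cdiff_eps; intros eps He.
    set (A := Cmod a) in *.
    exists (Rmin (A / 2) (eps * (A * A * A) / 2)); split.
    { apply Rmin_glb_lt; [lra |].
      assert (0 < eps * (A * A * A)) by (repeat apply Rmult_lt_0_compat; lra); lra. }
    intros w Hw.
    assert (H1 := Rlt_le_trans _ _ _ Hw (Rmin_l _ _)).
    assert (H2 := Rlt_le_trans _ _ _ Hw (Rmin_r _ _)).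
    assert (Hwa : A / 2 < Cmod w).
    { assert (T := Cmod_minus_ge a w); rewrite Cmod_minus_sym in T.
      fold A in T; lra. }
    assert (w <> 0) by (apply Cmod_gt_0; lra).
    replace (/ w - / a - - / (a * a) * (w - a))%C
      with ((w - a) * (w - a) / (w * a * a))%C by (field; auto).
    rewrite Cmod_div by (repeat apply Cmult_neq_0; auto).
    rewrite !Cmod_mult; fold A.
    set (D := Cmod (w - a)) in *.
    assert (0 <= D) by apply Cmod_ge_0.
    assert (0 < A * A) by nra.
    apply Rle_div_l; [apply Rmult_lt_0_compat; [nra | lra] |].
    assert (A * A * A / 2 <= Cmod w * A * A) by nra.
    assert (eps * (A * A * A / 2) <= eps * (Cmod w * A * A)) by nra.
    nra. }
  assert (K := Cdiff_comp (fun w => / w)%C f z _ _ I H).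
  replace (- l / (f z * f z))%C with (l * - / (f z * f z))%C by (field; auto).
  exact K.
Qed.

Lemma Cdiff_div (f g : C -> C) (z a b : C) : g z <> 0 ->
  Cdiff f z a -> Cdiff g z b ->
  Cdiff (fun w => f w / g w)%C z ((a * g z - f z * b) / (g z * g z))%C.
Proof.
  intros H0 Hf Hg.
  replace ((a * g z - f z * b) / (g z * g z))%C
    with (a * / g z + f z * (- b / (g z * g z)))%C by (field; auto).
  apply (Cdiff_mult f (fun w => / g w)%C); [exact Hf | apply Cdiff_inv; auto].
Qed.

Lemma is_derive_expansion (f : R -> R) (x l : R) : is_derive f x l ->
  forall eps, 0 < eps -> exists d, 0 < d /\
    forall h, Rabs h < d -> Rabs (f (x + h) - f x - l * h) <= eps * Rabs h.
Proof.
  intros [_ H] eps He.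
  destruct (H x (fun P HP => HP) (mkposreal eps He)) as [d Hd].
  exists d; split; [apply cond_pos |]; intros h Hh.
  assert (B : ball x d (x + h)).
  { unfold ball; simpl; unfold AbsRing_ball, abs, minus, plus, opp; simpl.
    replace (x + h + - x) with h by ring; exact Hh. }
  specialize (Hd _ B).
  unfold norm, scal, minus, plus, opp in Hd; simpl in Hd.
  unfold abs, mult in Hd; simpl in Hd.
  replace (f (x + h) - f x - l * h) with (f (x + h) + - f x + - (h * l)) by ring.
  replace (x + h + - x) with h in * by ring; exact Hd.
Qed.

(** The real part of [Cexp w - 1 - w] is a sum of the remainders of [exp] and
    [cos] and a product of two small terms; likewise for the imaginary part
    with [sin]. *)
Lemma Cdiff_Cexp_0 : Cdiff Cexp 0 1.
Proof.
  apply Cdiff_eps; intros eps He.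
  assert (E1 : is_derive exp 0 1) by (auto_derive; [auto | rewrite exp_0; ring]).
  assert (E2 : is_derive cos 0 0) by (auto_derive; [auto | rewrite sin_0; ring]).
  assert (E3 : is_derive sin 0 1) by (auto_derive; [auto | rewrite cos_0; ring]).
  set (e := Rmin 1 (eps / 16)).
  assert (He' : 0 < e) by (apply Rmin_glb_lt; lra).
  destruct (is_derive_expansion _ _ _ E1 e He') as [d1 [Hd1 F1]].
  destruct (is_derive_expansion _ _ _ E2 e He') as [d2 [Hd2 F2]].
  destruct (is_derive_expansion _ _ _ E3 e He') as [d3 [Hd3 F3]].
  exists (Rmin (Rmin d1 d2) (Rmin d3 e)); split.
  { repeat apply Rmin_glb_lt; lra. }
  intros w Hw; replace (w - 0)%C with w in * by ring.
  destruct w as [a b].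
  set (D := Cmod (a, b)) in *.
  assert (Ha : Rabs a <= D) by apply (re_le_Cmod (a, b)).
  assert (Hb : Rabs b <= D) by apply (im_le_Cmod (a, b)).
  apply Rmin_Rgt_l in Hw as [Hw1 Hw2].
  apply Rmin_Rgt_l in Hw1 as [G1 G2]; apply Rmin_Rgt_l in Hw2 as [G3 G4].
  specialize (F1 a ltac:(lra)); specialize (F2 b ltac:(lra)); specialize (F3 b ltac:(lra)).
  rewrite Rplus_0_l, exp_0 in F1; rewrite Rplus_0_l, cos_0 in F2; rewrite Rplus_0_l, sin_0 in F3.
  rewrite Cexp_0.
  eapply Rle_trans; [apply Cmod_le_Re_Im |].
  unfold Cexp; simpl.
  assert (He1 := Rmin_l 1 (eps / 16)); assert (He2 := Rmin_r 1 (eps / 16)); fold e in He1, He2.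
  assert (C1 : Rabs (exp a - 1 - 1 * a) <= e * D) by (eapply Rle_trans; [exact F1 | nra]).
  assert (C2 : Rabs (cos b - 1 - 0 * b) <= e * D) by (eapply Rle_trans; [exact F2 | nra]).
  assert (C3 : Rabs (sin b - 0 - 1 * b) <= e * D) by (eapply Rle_trans; [exact F3 | nra]).
  apply Rabs_le_between in C1; apply Rabs_le_between in C2; apply Rabs_le_between in C3.
  apply Rabs_le_between in Ha; apply Rabs_le_between in Hb.
  assert (HD : 0 <= D) by apply Cmod_ge_0.
  assert (Ea : Rabs (exp a - 1) <= 2 * D) by (apply Rabs_le_between; nra).
  apply Rabs_le_between in Ea.
  assert (Sb := SIN_bound b); assert (Cb := COS_bound b).
  assert (S2 : Rabs (sin b) <= 2 * D) by (apply Rabs_le_between; nra).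
  apply Rabs_le_between in S2.
  assert (HeD : 0 <= e * D) by nra.
  assert (X1 : Rabs (exp a * cos b + - (1) + - (1 * (a) - 0 * b)) <= 8 * e * D).
  { replace (exp a * cos b + - (1) + - (1 * a - 0 * b)) with
      ((exp a - 1 - 1 * a) + (exp a - 1) * (cos b - 1 - 0*b) + (cos b - 1 - 0*b)) by ring.
    assert (Rabs ((exp a - 1) * (cos b - 1 - 0 * b)) <= 2 * D * (e * D)).
    { rewrite Rabs_mult; apply Rmult_le_compat; try apply Rabs_pos; apply Rabs_le_between; lra. }
    apply Rabs_le_between in H; apply Rabs_le_between.
    assert (2 * D * (e * D) <= 2 * (e * D)) by nra. lra. }
  assert (X2 : Rabs (exp a * sin b + - 0 + - (1 * b + 0 * a)) <= 8 * e * D).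
  { replace (exp a * sin b + - 0 + - (1 * b + 0 * a)) with
      ((sin b - 0 - 1 * b) + (exp a - 1) * sin b) by ring.
    assert (Rabs ((exp a - 1) * sin b) <= 2 * D * (2 * e)).
    { rewrite Rabs_mult; apply Rmult_le_compat; try apply Rabs_pos; apply Rabs_le_between; lra. }
    apply Rabs_le_between in H; apply Rabs_le_between. lra. }
  assert (16 * e * D <= eps * D) by nra. lra.
Qed.

Lemma Ccont_plus (f g : C -> C) (z : C) : Ccont f z -> Ccont g z ->
  Ccont (fun w => f w + g w)%C z.
Proof. exact (@continuous_plus CU C_AbsRing (AbsRing_NormedModule C_AbsRing) f g z). Qed.

Lemma Ccont_minus (f g : C -> C) (z : C) : Ccont f z -> Ccont g z ->
  Ccont (fun w => f w - g w)%C z.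
Proof. exact (@continuous_minus CU C_AbsRing (AbsRing_NormedModule C_AbsRing) f g z). Qed.

Lemma Ccont_mult (f g : C -> C) (z : C) : Ccont f z -> Ccont g z ->
  Ccont (fun w => f w * g w)%C z.
Proof. exact (@continuous_mult CU C_AbsRing f g z). Qed.

Lemma Ccont_const (c z : C) : Ccont (fun _ => c) z.
Proof. eapply Cdiff_Ccont, Cdiff_const. Qed.

Lemma Ccont_scal (c : C) (f : C -> C) (z : C) : Ccont f z ->
  Ccont (fun w => c * f w)%C z.
Proof. intros Hf; apply (Ccont_mult (fun _ => c)); [apply Ccont_const | exact Hf]. Qed.

Lemma Re_conj_mult_self (w : C) : Re (Cconj w * w)%C = Cmod w ^ 2.
Proof. rewrite Cmod2_alt; unfold Re, Im, Cconj; simpl; ring. Qed.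

(** Translate the case of the origin by the addition formula. *)
Lemma Cdiff_Cexp (z : C) : Cdiff Cexp z (Cexp z).
Proof.
  assert (K := Cdiff_mult (fun _ => Cexp z) (fun w => Cexp (w - z)) z 0 1
    (Cdiff_const (Cexp z) z)).
  simpl in K; replace (0 * Cexp (z - z) + Cexp z * 1)%C with (Cexp z) in K by ring.
  eapply (Cdiff_ext_loc (fun w => Cexp z * Cexp (w - z))%C _ z _ 1 Rlt_0_1).
  { intros w _; rewrite <- Cexp_plus; f_equal; ring. }
  apply K.
  assert (L := Cdiff_comp Cexp (fun w => w - z)%C z 1 (1 - 0)).
  replace ((1 - 0) * 1)%C with (RtoC 1) in L by ring.
  apply L.
  - replace (z - z)%C with (RtoC 0) by ring; apply Cdiff_Cexp_0.
  - apply Cdiff_minus; [apply Cdiff_id | apply Cdiff_const].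
Qed.

(** * Bisection *)

Lemma nested_intervals (u v : nat -> R) :
  (forall n, u n <= u (S n)) -> (forall n, v (S n) <= v n) ->
  (forall n, u n <= v n) -> exists x, forall n, u n <= x <= v n.
Proof.
  intros Hu Hv Huv.
  assert (Mu : forall n m, (n <= m)%nat -> u n <= u m).
  { intros n m H; induction H; [lra | specialize (Hu m); lra]. }
  assert (Mv : forall n m, (n <= m)%nat -> v m <= v n).
  { intros n m H; induction H; [lra | specialize (Hv m); lra]. }
  assert (Muv : forall n m, u m <= v n).
  { intros n m; destruct (Nat.le_ge_cases n m) as [H | H].
    - specialize (Mv n m H); specialize (Huv m); lra.
    - specialize (Mu m n H); specialize (Huv n); lra. }
  destruct (completeness (fun y => exists n, y = u n)) as [x [Hx1 Hx2]].
  - exists (v O); intros y [n ->]; apply Muv.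
  - exists (u O), O; reflexivity.
  - exists x; intros n; split.
    + apply Hx1; exists n; reflexivity.
    + apply Hx2; intros y [m ->]; apply Muv.
Qed.

(** A property of the boxes [a, a + q W] x [c, c + q H] that passes from the
    four quarters of a box to the box, and holds for all small boxes around each
    point, holds for the whole box: otherwise repeated quartering would give bad
    boxes that shrink to a point.  It serves both for Goursat's theorem and for
    the existence of maxima. *)
Lemma bisection (P : R -> R -> R -> Prop) (A B W H : R) :
  0 <= W -> 0 <= H ->
  (forall a c q, 0 < q ->
     P a c (q / 2) -> P (a + q / 2 * W) c (q / 2) ->
     P a (c + q / 2 * H) (q / 2) ->
     P (a + q / 2 * W) (c + q / 2 * H) (q / 2) -> P a c q) ->
  (forall x y, A <= x <= A + W -> B <= y <= B + H ->
     exists d, 0 < d /\ forall a c q, 0 < q < d ->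
       a <= x <= a + q * W -> c <= y <= c + q * H -> P a c q) ->
  P A B 1.
Proof.
  intros HW HH Hsplit Hloc; apply NNPP; intros Hbad.
  set (R3 := (R * R * R)%type).
  assert (step : forall s : R3, exists s' : R3,
    let '(a, c, q) := s in let '(a', c', q') := s' in
    0 < q -> ~ P a c q ->
    q' = q / 2 /\ ~ P a' c' q' /\ a <= a' <= a + q / 2 * W
    /\ c <= c' <= c + q / 2 * H).
  { intros [[a c] q].
    destruct (Rlt_dec 0 q) as [Hq | Hq]; [| exists (a, c, q); tauto].
    destruct (classic (P a c q)) as [HP | HP]; [exists (a, c, q); tauto |].
    assert (QW : 0 <= q / 2 * W) by (apply Rmult_le_pos; lra).
    assert (QH : 0 <= q / 2 * H) by (apply Rmult_le_pos; lra).
    destruct (classic (P a c (q / 2))) as [H1 | H1];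
      [| exists (a, c, q / 2); intros _ _; repeat split; auto; lra].
    destruct (classic (P (a + q / 2 * W) c (q / 2))) as [H2 | H2];
      [| exists (a + q / 2 * W, c, q / 2); intros _ _; repeat split; auto; lra].
    destruct (classic (P a (c + q / 2 * H) (q / 2))) as [H3 | H3];
      [| exists (a, c + q / 2 * H, q / 2); intros _ _; repeat split; auto; lra].
    destruct (classic (P (a + q / 2 * W) (c + q / 2 * H) (q / 2))) as [H4 | H4];
      [| exists (a + q / 2 * W, c + q / 2 * H, q / 2); intros _ _;
         repeat split; auto; lra].
    exfalso; apply HP; apply Hsplit; auto. }
  set (next s := proj1_sig (constructive_indefinite_description _ (step s))).
  assert (Hnext := fun s => proj2_sig (constructive_indefinite_description _ (step s))).
  fold next in Hnext.
  set (st := fix st n := match n with O => (A, B, 1) : R3 | S n => next (st n) end).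
  set (a := fun n => fst (fst (st n))); set (c := fun n => snd (fst (st n))).
  set (q := fun n => snd (st n)).
  assert (inv : forall n, q n = / 2 ^ n /\ ~ P (a n) (c n) (q n)).
  { induction n as [| n [IH1 IH2]].
    - split; [unfold q; simpl; lra | exact Hbad].
    - specialize (Hnext (st n)); unfold a, c, q in *; simpl.
      fold (next (st n)) in Hnext.
      destruct (st n) as [[a0 c0] q0]; simpl in *.
      destruct (next (a0, c0, q0)) as [[a1 c1] q1]; simpl in *.
      assert (0 < q0) by (rewrite IH1; apply Rinv_0_lt_compat, pow_lt; lra).
      destruct Hnext as [E [N _]]; auto; split; [| exact N].
      rewrite E, IH1; field; apply pow_nonzero; lra. }
  assert (qpos : forall n, 0 < q n).
  { intros n; rewrite (proj1 (inv n)); apply Rinv_0_lt_compat, pow_lt; lra. }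
  assert (mono : forall n, q (S n) = q n / 2 /\ a n <= a (S n) <= a n + q n / 2 * W
    /\ c n <= c (S n) <= c n + q n / 2 * H).
  { intros n; specialize (inv n); specialize (qpos n).
    specialize (Hnext (st n)); unfold a, c, q in *; simpl.
    fold (next (st n)) in Hnext.
    destruct (st n) as [[a0 c0] q0]; simpl in *.
    destruct (next (a0, c0, q0)) as [[a1 c1] q1]; simpl in *.
    destruct Hnext as [E [N M]]; tauto. }
  assert (px : exists x, forall n, a n <= x <= a n + q n * W).
  { apply (nested_intervals a (fun n => a n + q n * W)); intros n;
      specialize (qpos n); destruct (mono n) as [E [M1 M2]]; rewrite ?E; nra. }
  assert (py : exists y, forall n, c n <= y <= c n + q n * H).
  { apply (nested_intervals c (fun n => c n + q n * H)); intros n;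
      specialize (qpos n); destruct (mono n) as [E [M1 M2]]; rewrite ?E; nra. }
  destruct px as [x Hx]; destruct py as [y Hy].
  destruct (Hloc x y) as [d [Hd Hl]].
  { specialize (Hx O); unfold a, q in Hx; simpl in Hx; lra. }
  { specialize (Hy O); unfold c, q in Hy; simpl in Hy; lra. }
  destruct (pow_lt_1_zero (/ 2) ltac:(rewrite Rabs_pos_eq; lra) d Hd) as [N HN].
  specialize (HN N (le_n N)).
  rewrite Rabs_pos_eq, pow_inv in HN by (apply pow_le; lra).
  destruct (inv N) as [E NP]; apply NP; apply Hl; auto.
  specialize (qpos N); lra.
Qed.

(** * Integrals of complex-valued functions of a real variable *)

(** Equations between values of integrands are typed in [R] as a normed module;
    [ring] and [field] need them typed in [R] itself. *)
Ltac as_R := match goal with |- @eq _ ?l ?r => change (@eq R l r) end.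

Definition Rcont (f : R -> C) (t : R) : Prop := @continuous R_UniformSpace CU f t.

(** Integrating the components separately makes the existence and the linearity
    of real integrals directly available. *)
Definition C_RInt (f : R -> C) (a b : R) : C :=
  (RInt (fun t => Re (f t)) a b, RInt (fun t => Im (f t)) a b).

Lemma Rcont_eps (f : R -> C) (t : R) :
  Rcont f t <->
  forall eps, 0 < eps -> exists d, 0 < d /\
    forall s, Rabs (s - t) < d -> Cmod (f s - f t) < eps.
Proof.
  split.
  - intros H eps He.
    apply filterlim_locally with (eps := mkposreal eps He) in H.
    destruct H as [d Hd]; exists d; split; [apply cond_pos | exact Hd].
  - intros H; apply filterlim_locally; intros eps.
    destruct (H eps (cond_pos eps)) as [d [Hd Hf]].
    exists (mkposreal d Hd); exact Hf.
Qed.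

Lemma Rcont_comp (g : C -> C) (f : R -> C) (t : R) :
  Rcont f t -> Ccont g (f t) -> Rcont (fun s => g (f s)) t.
Proof. intros Hf Hg; exact (@continuous_comp R_UniformSpace CU CU f g t Hf Hg). Qed.

Lemma Rcont_Re (f : R -> C) (t : R) : Rcont f t -> continuous (fun s => Re (f s)) t.
Proof.
  intros H; apply filterlim_locally; intros eps.
  destruct (proj1 (Rcont_eps f t) H eps (cond_pos eps)) as [d [Hd Hf]].
  exists (mkposreal d Hd); intros s Hs; specialize (Hf s Hs).
  eapply Rle_lt_trans; [| exact Hf].
  eapply Rle_trans; [| apply re_le_Cmod]; apply Req_le; reflexivity.
Qed.

Lemma Rcont_Im (f : R -> C) (t : R) : Rcont f t -> continuous (fun s => Im (f s)) t.
Proof.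
  intros H; apply filterlim_locally; intros eps.
  destruct (proj1 (Rcont_eps f t) H eps (cond_pos eps)) as [d [Hd Hf]].
  exists (mkposreal d Hd); intros s Hs; specialize (Hf s Hs).
  eapply Rle_lt_trans; [| exact Hf].
  eapply Rle_trans; [| apply im_le_Cmod]; apply Req_le; reflexivity.
Qed.

Lemma Rcont_const (c : C) (t : R) : Rcont (fun _ => c) t.
Proof. apply (@continuous_const R_UniformSpace CU). Qed.

Lemma Rcont_mult (f g : R -> C) (t : R) :
  Rcont f t -> Rcont g t -> Rcont (fun s => f s * g s)%C t.
Proof. exact (@continuous_mult R_UniformSpace C_AbsRing f g t). Qed.

Lemma Rcont_minus (f g : R -> C) (t : R) :
  Rcont f t -> Rcont g t -> Rcont (fun s => f s - g s)%C t.
Proof.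
  exact (@continuous_minus R_UniformSpace C_AbsRing (AbsRing_NormedModule C_AbsRing) f g t).
Qed.

Definition Rcont_on (f : R -> C) (a b : R) : Prop := forall t, a <= t <= b -> Rcont f t.

Lemma ex_RInt_Re (f : R -> C) (a b : R) : a <= b -> Rcont_on f a b ->
  ex_RInt (fun t => Re (f t)) a b.
Proof.
  intros Hab Hf; apply (@ex_RInt_continuous R_CompleteNormedModule).
  rewrite Rmin_left, Rmax_right by lra.
  intros t Ht; apply Rcont_Re, Hf, Ht.
Qed.

Lemma ex_RInt_Im (f : R -> C) (a b : R) : a <= b -> Rcont_on f a b ->
  ex_RInt (fun t => Im (f t)) a b.
Proof.
  intros Hab Hf; apply (@ex_RInt_continuous R_CompleteNormedModule).
  rewrite Rmin_left, Rmax_right by lra.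
  intros t Ht; apply Rcont_Im, Hf, Ht.
Qed.

Lemma C_RInt_ext (f g : R -> C) (a b : R) : a <= b ->
  (forall t, a <= t <= b -> f t = g t) -> C_RInt f a b = C_RInt g a b.
Proof.
  intros Hab E; unfold C_RInt; f_equal; apply RInt_ext;
    rewrite Rmin_left, Rmax_right by lra; intros t Ht; rewrite E by lra; reflexivity.
Qed.

Lemma C_RInt_plus (f g : R -> C) (a b : R) : a <= b -> Rcont_on f a b -> Rcont_on g a b ->
  C_RInt (fun t => f t + g t)%C a b = (C_RInt f a b + C_RInt g a b)%C.
Proof.
  intros Hab Hf Hg; unfold C_RInt, Cplus; simpl; f_equal.
  - apply (@RInt_plus R_CompleteNormedModule); apply ex_RInt_Re; auto.
  - apply (@RInt_plus R_CompleteNormedModule); apply ex_RInt_Im; auto.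
Qed.

Lemma C_RInt_scal (c : C) (f : R -> C) (a b : R) : a <= b -> Rcont_on f a b ->
  C_RInt (fun t => c * f t)%C a b = (c * C_RInt f a b)%C.
Proof.
  intros Hab Hf.
  assert (Er := ex_RInt_Re f a b Hab Hf); assert (Ei := ex_RInt_Im f a b Hab Hf).
  assert (S : forall k h, ex_RInt h a b -> ex_RInt (fun t => k * h t) a b).
  { intros k h; apply (@ex_RInt_scal R_CompleteNormedModule). }
  assert (SE : forall k h, ex_RInt h a b ->
    RInt (fun t => k * h t) a b = k * RInt h a b).
  { intros k h; apply (@RInt_scal R_CompleteNormedModule). }
  destruct c as [x y]; unfold C_RInt, Cmult; simpl; f_equal.
  - rewrite <- !SE by auto.
    apply (@RInt_minus R_CompleteNormedModule); apply S; auto.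
  - rewrite <- !SE by auto.
    apply (@RInt_plus R_CompleteNormedModule); apply S; auto.
Qed.

Lemma C_RInt_minus (f g : R -> C) (a b : R) : a <= b -> Rcont_on f a b -> Rcont_on g a b ->
  C_RInt (fun t => f t - g t)%C a b = (C_RInt f a b - C_RInt g a b)%C.
Proof.
  intros Hab Hf Hg.
  transitivity (C_RInt (fun t => f t + (-(1)) * g t)%C a b).
  - apply C_RInt_ext; auto; intros; ring.
  - rewrite C_RInt_plus, C_RInt_scal; auto; [ring |].
    intros t Ht; apply Rcont_mult; [apply Rcont_const | apply Hg, Ht].
Qed.

Lemma C_RInt_Chasles (f : R -> C) (a b c : R) : a <= b <= c -> Rcont_on f a c ->
  C_RInt f a c = (C_RInt f a b + C_RInt f b c)%C.
Proof.
  intros [Hab Hbc] Hf.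
  assert (H1 : Rcont_on f a b) by (intros t Ht; apply Hf; lra).
  assert (H2 : Rcont_on f b c) by (intros t Ht; apply Hf; lra).
  unfold C_RInt, Cplus; apply injective_projections; cbn [fst snd]; symmetry.
  - apply (@RInt_Chasles R_CompleteNormedModule (fun t => Re (f t)));
      apply ex_RInt_Re; auto.
  - apply (@RInt_Chasles R_CompleteNormedModule (fun t => Im (f t)));
      apply ex_RInt_Im; auto.
Qed.

Lemma C_RInt_affine (u v : C) (a b : R) :
  C_RInt (fun t => u + t * v)%C a b = ((b - a) * u + (b * b - a * a) / 2 * v)%C.
Proof.
  assert (K : forall x y, RInt (fun t => x + (t * y)) a b
     = (b - a) * x + (b * b - a * a) / 2 * y).
  { intros x y; apply is_RInt_unique.
    replace ((b - a) * x + (b * b - a * a) / 2 * y)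
      with (minus (b * x + b * b / 2 * y) (a * x + a * a / 2 * y))
      by (unfold minus, plus, opp; simpl; field).
    apply (is_RInt_derive (fun t => t * x + t * t / 2 * y)).
    - intros t _; auto_derive; [auto |].
      as_R; field.
    - intros t _; apply (@ex_derive_continuous R_AbsRing R_NormedModule); auto_derive; auto. }
  destruct u as [u1 u2]; destruct v as [v1 v2]; unfold C_RInt.
  apply injective_projections; simpl.
  - transitivity (RInt (fun t => u1 + t * v1) a b).
    + apply RInt_ext; intros; as_R; ring.
    + rewrite K; field.
  - transitivity (RInt (fun t => u2 + t * v2) a b).
    + apply RInt_ext; intros; as_R; ring.
    + rewrite K; field.
Qed.

Lemma C_RInt_const (c : C) (a b : R) : C_RInt (fun _ => c) a b = ((b - a) * c)%C.
Proof.
  unfold C_RInt; destruct c as [x y]; simpl.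
  rewrite !RInt_const; apply injective_projections; unfold scal; simpl; unfold mult; simpl; ring.
Qed.

Lemma Cmod_C_RInt_le (f : R -> C) (a b M : R) : a <= b -> Rcont_on f a b ->
  (forall t, a <= t <= b -> Cmod (f t) <= M) -> Cmod (C_RInt f a b) <= (b - a) * M.
Proof.
  intros Hab Hf HM.
  set (I := C_RInt f a b).
  destruct (Req_dec (Cmod I) 0) as [E | E].
  { rewrite E; apply Rmult_le_pos; [lra |].
    eapply Rle_trans; [apply Cmod_ge_0 | apply (HM a); lra]. }
  assert (Hp := Cmod_ge_0 I).
  apply Rmult_le_reg_l with (Cmod I); [lra |].
  (* multiply by [Cconj I], which makes the integral real and nonnegative *)
  assert (HcI : C_RInt (fun t => Cconj I * f t)%C a b = (Cconj I * I)%C)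
    by (apply C_RInt_scal; auto).
  assert (Hc : Rcont_on (fun t => Cconj I * f t)%C a b).
  { intros t Ht; apply Rcont_mult; [apply Rcont_const | apply Hf, Ht]. }
  replace (Cmod I * Cmod I) with (Re (Cconj I * I)%C)
    by (assert (T := Cmod2_alt I); rewrite re_mult, re_conj;
        change (Im (Cconj I)) with (- Im I); lra).
  rewrite <- HcI; unfold C_RInt at 1; simpl.
  replace (Cmod I * ((b - a) * M)) with (RInt (fun _ => Cmod I * M) a b)
    by (rewrite RInt_const; unfold scal; simpl; unfold mult; simpl; ring).
  apply RInt_le; auto.
  - apply (ex_RInt_Re (fun t => Cconj I * f t)%C); auto.
  - apply ex_RInt_const.
  - intros t Ht.
    eapply Rle_trans; [apply Rle_abs |].
    eapply Rle_trans; [apply (re_le_Cmod (Cconj I * f t)%C) |].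
    rewrite Cmod_mult, Cmod_conj.
    apply Rmult_le_compat_l; [lra | apply HM; lra].
Qed.

(** * Goursat's theorem on rectangles *)

Lemma Rcont_horizontal (y t : R) : Rcont (fun x => (x, y)) t.
Proof.
  apply Rcont_eps; intros eps He; exists eps; split; [exact He |]; intros s Hs.
  replace ((s, y) - (t, y))%C with (RtoC (s - t))
    by (apply injective_projections; simpl; ring).
  rewrite Cmod_R; exact Hs.
Qed.

Lemma Rcont_vertical (x t : R) : Rcont (fun y => (x, y)) t.
Proof.
  apply Rcont_eps; intros eps He; exists eps; split; [exact He |]; intros s Hs.
  replace ((x, s) - (x, t))%C with (Ci * RtoC (s - t))%C
    by (apply injective_projections; simpl; ring).
  rewrite Cmod_mult, Cmod_Ci, Cmod_R; lra.
Qed.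

Definition Ccont_rect (g : C -> C) (a b c d : R) : Prop :=
  forall x y, a <= x <= b -> c <= y <= d -> Ccont g (x, y).

(** The integral of [g z dz] around the rectangle, counterclockwise. *)
Definition rect_int (g : C -> C) (a b c d : R) : C :=
  (C_RInt (fun x => g (x, c)) a b - C_RInt (fun x => g (x, d)) a b
   + Ci * (C_RInt (fun y => g (b, y)) c d - C_RInt (fun y => g (a, y)) c d))%C.

Lemma Rcont_on_horizontal (g : C -> C) (a b c d y : R) :
  Ccont_rect g a b c d -> c <= y <= d -> Rcont_on (fun x => g (x, y)) a b.
Proof.
  intros Hg Hy t Ht; apply (Rcont_comp g (fun x => (x, y)));
    [apply Rcont_horizontal | apply Hg; auto].
Qed.

Lemma Rcont_on_vertical (g : C -> C) (a b c d x : R) :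
  Ccont_rect g a b c d -> a <= x <= b -> Rcont_on (fun y => g (x, y)) c d.
Proof.
  intros Hg Hx t Ht; apply (Rcont_comp g (fun y => (x, y)));
    [apply Rcont_vertical | apply Hg; auto].
Qed.

Lemma rect_int_minus (g h : C -> C) (a b c d : R) : a <= b -> c <= d ->
  Ccont_rect g a b c d -> Ccont_rect h a b c d ->
  rect_int (fun z => g z - h z)%C a b c d = (rect_int g a b c d - rect_int h a b c d)%C.
Proof.
  intros Hab Hcd Hg Hh; unfold rect_int.
  rewrite (C_RInt_minus (fun x => g (x, c)) (fun x => h (x, c))),
    (C_RInt_minus (fun x => g (x, d)) (fun x => h (x, d))),
    (C_RInt_minus (fun x => g (b, x)) (fun x => h (b, x))),
    (C_RInt_minus (fun x => g (a, x)) (fun x => h (a, x)));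
    try ring; auto;
    try (eapply Rcont_on_horizontal; eauto; lra); eapply Rcont_on_vertical; eauto; lra.
Qed.

(** The special case of Cauchy's theorem that a direct computation gives; the
    local step of Goursat's theorem subtracts the affine approximation. *)
Lemma rect_int_affine (u v : C) (a b c d : R) :
  rect_int (fun z => u + z * v)%C a b c d = 0.
Proof.
  assert (H : forall y, C_RInt (fun x => u + (x, y) * v)%C a b
    = ((b - a) * (u + Ci * y * v) + (b * b - a * a) / 2 * v)%C).
  { intros y; rewrite <- C_RInt_affine; unfold C_RInt; f_equal;
      apply RInt_ext; intros; as_R; simpl; ring. }
  assert (V : forall x, C_RInt (fun y => u + (x, y) * v)%C c d
    = ((d - c) * (u + x * v) + (d * d - c * c) / 2 * (Ci * v))%C).
  { intros y; rewrite <- C_RInt_affine; unfold C_RInt; f_equal;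
      apply RInt_ext; intros; as_R; simpl; ring. }
  unfold rect_int; rewrite !H, !V.
  apply injective_projections; simpl; field.
Qed.

Lemma rect_int_split (g : C -> C) (a m b c n d : R) :
  a <= m <= b -> c <= n <= d -> Ccont_rect g a b c d ->
  rect_int g a b c d
  = (rect_int g a m c n + rect_int g m b c n
     + rect_int g a m n d + rect_int g m b n d)%C.
Proof.
  intros Hm Hn Hg; unfold rect_int.
  rewrite (C_RInt_Chasles (fun x => g (x, c)) a m b),
    (C_RInt_Chasles (fun x => g (x, d)) a m b),
    (C_RInt_Chasles (fun x => g (b, x)) c n d),
    (C_RInt_Chasles (fun x => g (a, x)) c n d);
    try ring; auto;
    try (eapply Rcont_on_horizontal; eauto; lra); eapply Rcont_on_vertical; eauto; lra.
Qed.

Lemma Cmod_rect_int_le (g : C -> C) (a b c d M : R) : a <= b -> c <= d ->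
  Ccont_rect g a b c d ->
  (forall x y, a <= x <= b -> c <= y <= d -> Cmod (g (x, y)) <= M) ->
  Cmod (rect_int g a b c d) <= 2 * ((b - a) + (d - c)) * M.
Proof.
  intros Hab Hcd Hg HM; unfold rect_int.
  assert (H1 : Cmod (C_RInt (fun x => g (x, c)) a b) <= (b - a) * M).
  { apply Cmod_C_RInt_le; auto; [eapply Rcont_on_horizontal; eauto; lra |].
    intros; apply HM; lra. }
  assert (H2 : Cmod (C_RInt (fun x => g (x, d)) a b) <= (b - a) * M).
  { apply Cmod_C_RInt_le; auto; [eapply Rcont_on_horizontal; eauto; lra |].
    intros; apply HM; lra. }
  assert (H3 : Cmod (C_RInt (fun y => g (b, y)) c d) <= (d - c) * M).
  { apply Cmod_C_RInt_le; auto; [eapply Rcont_on_vertical; eauto; lra |].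
    intros; apply HM; lra. }
  assert (H4 : Cmod (C_RInt (fun y => g (a, y)) c d) <= (d - c) * M).
  { apply Cmod_C_RInt_le; auto; [eapply Rcont_on_vertical; eauto; lra |].
    intros; apply HM; lra. }
  assert (Tm : forall x y, Cmod (x - y) <= Cmod x + Cmod y).
  { intros x y; unfold Cminus; eapply Rle_trans; [apply Cmod_triangle |].
    rewrite Cmod_opp; lra. }
  eapply Rle_trans; [apply Cmod_triangle |].
  rewrite Cmod_mult, Cmod_Ci.
  assert (T1 := Tm (C_RInt (fun x => g (x, c)) a b) (C_RInt (fun x => g (x, d)) a b)).
  assert (T2 := Tm (C_RInt (fun y => g (b, y)) c d) (C_RInt (fun y => g (a, y)) c d)).
  lra.
Qed.

(** Bisection with the property that the integral around a box of scale [q] is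
    at most [eps * q ^ 2].  The bound is additive over the quarters, since
    [4 * (q / 2) ^ 2 = q ^ 2].  Around a small box of scale [q], the integrand
    differs from an affine function by [o(q)] and the perimeter is [O(q)]. *)
Lemma Goursat_rectangle (g : C -> C) (A B W H : R) : 0 <= W -> 0 <= H ->
  (forall x y, A <= x <= A + W -> B <= y <= B + H -> exists l, Cdiff g (x, y) l) ->
  rect_int g A (A + W) B (B + H) = 0.
Proof.
  intros HW HH Hg.
  assert (Cg : forall a b c d, A <= a -> b <= A + W -> B <= c -> d <= B + H ->
    Ccont_rect g a b c d).
  { intros a b c d ? ? ? ? x y Hx Hy; destruct (Hg x y) as [l Hl]; try lra.
    eapply Cdiff_Ccont; eauto. }
  set (S := W + H + 1).
  assert (Small : forall eps, 0 < eps -> Cmod (rect_int g A (A + W) B (B + H)) <= eps).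
  { intros eps He.
    set (P := fun a c q => 0 < q -> A <= a -> a + q * W <= A + W ->
      B <= c -> c + q * H <= B + H ->
      Cmod (rect_int g a (a + q * W) c (c + q * H)) <= eps * (q * q)).
    assert (HP : P A B 1).
    { apply (bisection P A B W H HW HH); unfold P.
      - intros a c q _ H1 H2 H3 H4 Hq Ha HaW Hc HcH.
        assert (QW : 0 <= q / 2 * W) by (apply Rmult_le_pos; lra).
        assert (QH : 0 <= q / 2 * H) by (apply Rmult_le_pos; lra).
        specialize (H1 ltac:(lra) ltac:(lra) ltac:(lra) ltac:(lra) ltac:(lra)).
        specialize (H2 ltac:(lra) ltac:(lra) ltac:(lra) ltac:(lra) ltac:(lra)).
        specialize (H3 ltac:(lra) ltac:(lra) ltac:(lra) ltac:(lra) ltac:(lra)).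
        specialize (H4 ltac:(lra) ltac:(lra) ltac:(lra) ltac:(lra) ltac:(lra)).
        rewrite (rect_int_split g a (a + q / 2 * W) _ c (c + q / 2 * H)).
        2, 3: lra.
        2: apply Cg; lra.
        replace (a + q / 2 * W + q / 2 * W) with (a + q * W) in * by field.
        replace (c + q / 2 * H + q / 2 * H) with (c + q * H) in * by field.
        eapply Rle_trans; [apply Cmod_triangle |].
        eapply Rle_trans; [apply Rplus_le_compat_r, Cmod_triangle |].
        eapply Rle_trans; [apply Rplus_le_compat_r, Rplus_le_compat_r, Cmod_triangle |].
        lra.
      - intros x y Hx Hy; destruct (Hg x y Hx Hy) as [l Hl].
        set (eta := eps / (2 * (S * S))).
        assert (HS : 1 <= S) by (unfold S; lra).
        assert (Heta : 0 < eta) by (apply Rdiv_lt_0_compat; nra).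
        destruct (proj1 (Cdiff_eps g (x, y) l) Hl eta Heta) as [d [Hd Hgd]].
        exists (d / S); split; [apply Rdiv_lt_0_compat; lra |].
        intros a c q [_ Hqd] Hxa Hyc Hq Ha HaW Hc HcH.
        assert (QW : 0 <= q * W) by (apply Rmult_le_pos; lra).
        assert (QH : 0 <= q * H) by (apply Rmult_le_pos; lra).
        apply Rlt_div_r in Hqd; [| lra].
        set (lin := fun z : C => ((g (x, y) - l * (x, y)) + z * l)%C).
        assert (Clin : Ccont_rect lin a (a + q * W) c (c + q * H)).
        { intros u v _ _; unfold lin; eapply Cdiff_Ccont.
          apply (Cdiff_plus (fun _ => _) (fun z => z * l)%C); [apply Cdiff_const |].
          apply (Cdiff_mult (fun z => z) (fun _ => l)); [apply Cdiff_id | apply Cdiff_const]. }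
        assert (E : rect_int g a (a + q * W) c (c + q * H)
          = rect_int (fun z => g z - lin z)%C a (a + q * W) c (c + q * H)).
        { rewrite rect_int_minus; try lra; auto.
          unfold lin; rewrite rect_int_affine; ring. }
        rewrite E.
        eapply Rle_trans; [apply (Cmod_rect_int_le _ _ _ _ _ (eta * (q * S))) |].
        + lra.
        + lra.
        + intros u v Hu Hv.
          destruct (Hg u v) as [k Hk]; try lra.
          eapply Cdiff_Ccont; apply Cdiff_minus; [exact Hk |].
          unfold lin; apply (Cdiff_plus (fun _ => _) (fun z => z * l)%C); [apply Cdiff_const |].
          apply (Cdiff_mult (fun z => z) (fun _ => l)); [apply Cdiff_id | apply Cdiff_const].
        + intros u v Hu Hv.
          assert (D : Cmod ((u, v) - (x, y)) <= q * W + q * H).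
          { eapply Rle_trans; [apply Cmod_le_Re_Im |]; simpl.
            apply Rplus_le_compat; apply Rabs_le_between; lra. }
          assert (D' : q * W + q * H <= q * S) by (unfold S; nra).
          unfold lin.
          replace (g (u, v) - (g (x, y) - l * (x, y) + (u, v) * l))%C
            with (g (u, v) - g (x, y) - l * ((u, v) - (x, y)))%C by ring.
          eapply Rle_trans; [apply Hgd; lra |].
          apply Rmult_le_compat_l; lra.
        + replace (a + q * W - a + (c + q * H - c)) with (q * (W + H)) by ring.
          apply Rle_trans with (2 * (q * S) * (eta * (q * S))).
          * apply Rmult_le_compat_r; [apply Rmult_le_pos; nra |].
            unfold S; nra.
          * unfold eta; apply Req_le; field; lra. }
    assert (K := HP ltac:(lra) ltac:(lra) ltac:(lra) ltac:(lra) ltac:(lra)).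
    rewrite !Rmult_1_l in K; lra. }
  apply Cmod_eq_0; apply Rle_antisym; [| apply Cmod_ge_0].
  apply le_epsilon; intros eps He; rewrite Rplus_0_l; apply Small, He.
Qed.

(** * Averages over circles *)

Definition circle_pt (s t : R) : C := (s * cos t, s * sin t).

Lemma Cmod_circle_pt (s t : R) : 0 <= s -> Cmod (circle_pt s t) = s.
Proof.
  intros Hs; assert (H := Cmod2_alt (circle_pt s t)); assert (H0 := Cmod_ge_0 (circle_pt s t)).
  assert (H2 := sin2_cos2 t); unfold Rsqr in H2.
  unfold circle_pt in *; simpl in *.
  assert (s * s * (sin t * sin t + cos t * cos t) = s * s) by (rewrite H2; ring).
  nra.
Qed.

Lemma Rcont_circle_pt (s t : R) : Rcont (circle_pt s) t.
Proof.
  apply Rcont_eps; intros eps He.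
  assert (C1 : continuous (fun t => s * cos t) t)
    by (apply (@ex_derive_continuous R_AbsRing R_NormedModule); auto_derive; auto).
  assert (C2 : continuous (fun t => s * sin t) t)
    by (apply (@ex_derive_continuous R_AbsRing R_NormedModule); auto_derive; auto).
  assert (He2 : 0 < eps / 2) by lra.
  apply filterlim_locally with (eps := mkposreal _ He2) in C1.
  apply filterlim_locally with (eps := mkposreal _ He2) in C2.
  destruct C1 as [d1 D1]; destruct C2 as [d2 D2].
  exists (Rmin d1 d2); split; [apply Rmin_glb_lt; apply cond_pos |].
  intros u Hu; apply Rmin_Rgt_l in Hu as [U1 U2].
  specialize (D1 u U1); specialize (D2 u U2).
  eapply Rle_lt_trans; [apply Cmod_le_Re_Im |].
  unfold ball in D1, D2; simpl in D1, D2.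
  unfold AbsRing_ball, abs, minus, plus, opp in D1, D2; simpl in D1, D2.
  unfold circle_pt; simpl; lra.
Qed.

(** [2 * PI] times the mean of [k] over the circle of radius [s]; there is no
    factor [dz], so a holomorphic function gives [2 * PI * k 0]. *)
Definition circle_int (k : C -> C) (s : R) : C := C_RInt (fun t => k (circle_pt s t)) 0 (2 * PI).

Lemma Rcont_on_circle (k : C -> C) (s : R) : 0 <= s ->
  (forall z, Cmod z = s -> Ccont k z) -> Rcont_on (fun t => k (circle_pt s t)) 0 (2 * PI).
Proof.
  intros Hs Hk t _; apply (Rcont_comp k (circle_pt s)); [apply Rcont_circle_pt |].
  apply Hk, Cmod_circle_pt, Hs.
Qed.

Lemma two_PI_pos : 0 < 2 * PI.
Proof. assert (T := PI_RGT_0); lra. Qed.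

(** In the coordinate [log z], the annulus becomes a rectangle of height
    [2 * PI]; by periodicity its horizontal sides cancel, and its vertical sides
    are the two circles. *)
Lemma circle_int_constant (f : C -> C) (r1 r2 : R) : 0 < r1 <= r2 ->
  (forall z, r1 <= Cmod z <= r2 -> exists l, Cdiff f z l) ->
  circle_int f r1 = circle_int f r2.
Proof.
  intros Hr Hf; assert (TP := two_PI_pos).
  assert (L : ln r1 <= ln r2).
  { destruct (Req_dec r1 r2) as [-> | N]; [lra |]; apply Rlt_le, ln_increasing; lra. }
  set (g := fun z => f (Cexp z)).
  assert (K := Goursat_rectangle g (ln r1) 0 (ln r2 - ln r1) (2 * PI) ltac:(lra) ltac:(lra)).
  rewrite Rplus_0_l in K.
  replace (ln r1 + (ln r2 - ln r1)) with (ln r2) in K by ring.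
  unfold rect_int in K.
  assert (E : forall r t, 0 < r -> g (ln r, t) = f (circle_pt r t)).
  { intros r t H; unfold g, Cexp, circle_pt; simpl; rewrite exp_ln; auto. }
  assert (Per : forall x, g (x, 2 * PI) = g (x, 0)).
  { intros x; unfold g, Cexp; simpl; rewrite cos_2PI, sin_2PI, cos_0, sin_0; reflexivity. }
  rewrite (C_RInt_ext (fun x => g (x, 2 * PI)) (fun x => g (x, 0))) in K by auto.
  rewrite (C_RInt_ext (fun y => g (ln r2, y)) (fun t => f (circle_pt r2 t))) in K
    by (try lra; intros; apply E; lra).
  rewrite (C_RInt_ext (fun y => g (ln r1, y)) (fun t => f (circle_pt r1 t))) in K
    by (try lra; intros; apply E; lra).
  fold (circle_int f r1) (circle_int f r2) in K.
  assert (K' : (Ci * (circle_int f r2 - circle_int f r1))%C = 0).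
  { rewrite <- K; [ring |].
    intros x y Hx Hy; destruct (Hf (Cexp (x, y))) as [l Hl].
    - rewrite Cmod_Cexp; simpl; rewrite <- (exp_ln r1), <- (exp_ln r2) by lra.
      assert (Mono : forall u v, u <= v -> exp u <= exp v).
      { intros u v [Huv | ->]; [apply Rlt_le, exp_increasing, Huv | lra]. }
      split; apply Mono; lra.
    - eexists; apply (Cdiff_comp f Cexp); [exact Hl | apply Cdiff_Cexp]. }
  replace (circle_int f r1) with (circle_int f r2 + Ci * (Ci * (circle_int f r2 - circle_int f r1)))%C.
  - rewrite K'; ring.
  - apply injective_projections; simpl; ring.
Qed.

(** * Cauchy's formula *)

Lemma Ceq_of_small (x y : C) : (forall eps, 0 < eps -> Cmod (x - y) <= eps) -> x = y.
Proof.
  intros H; assert (E : (x - y)%C = 0).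
  { apply Cmod_eq_0, Rle_antisym; [| apply Cmod_ge_0].
    apply le_epsilon; intros eps He; rewrite Rplus_0_l; apply H, He. }
  replace x with ((x - y) + y)%C by ring; rewrite E; ring.
Qed.

Lemma Cdiff_unique (f : C -> C) (z a b : C) : Cdiff f z a -> Cdiff f z b -> a = b.
Proof.
  intros Ha Hb.
  apply is_derive_Cdiff, is_C_derive_unique in Ha.
  apply is_derive_Cdiff, is_C_derive_unique in Hb; congruence.
Qed.

Lemma continuity_2d_circle_pt (k : C -> C) (s t : R) : Ccont k (circle_pt s t) ->
  forall eps, 0 < eps -> exists d : posreal,
    forall u v, Rabs (u - s) < d -> Rabs (v - t) < d ->
      Cmod (k (circle_pt u v) - k (circle_pt s t)) < eps.
Proof.
  intros Hk eps He.
  destruct (proj1 (Ccont_eps _ _) Hk eps He) as [e [He' Hke]].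
  assert (He2 : 0 < e / 2) by lra.
  assert (C1 : continuity_2d_pt (fun u v => u * cos v) s t).
  { apply continuity_2d_pt_mult; [apply continuity_2d_pt_id1 |].
    apply continuity_1d_2d_pt_comp; [apply continuity_cos | apply continuity_2d_pt_id2]. }
  assert (C2 : continuity_2d_pt (fun u v => u * sin v) s t).
  { apply continuity_2d_pt_mult; [apply continuity_2d_pt_id1 |].
    apply continuity_1d_2d_pt_comp; [apply continuity_sin | apply continuity_2d_pt_id2]. }
  destruct (C1 (mkposreal _ He2)) as [d1 D1]; destruct (C2 (mkposreal _ He2)) as [d2 D2].
  exists (mkposreal (Rmin d1 d2) (Rmin_stable_in_posreal d1 d2)); simpl.
  intros u v Hu Hv.
  apply Rmin_Rgt_l in Hu as [U1 U2]; apply Rmin_Rgt_l in Hv as [V1 V2].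
  specialize (D1 u v U1 V1); specialize (D2 u v U2 V2); simpl in D1, D2.
  apply Hke; eapply Rle_lt_trans; [apply Cmod_le_Re_Im |].
  unfold circle_pt; simpl; unfold Rminus in *; lra.
Qed.

(** The angles range over a compact interval, so continuity in the radius is
    uniform in the angle. *)
Lemma circle_int_continuous (k : C -> C) (R0 s0 : R) : 0 <= s0 < R0 ->
  (forall z, Cmod z < R0 -> Ccont k z) ->
  forall eps, 0 < eps -> exists d, 0 < d /\
    forall s, 0 <= s < R0 -> Rabs (s - s0) < d ->
      Cmod (circle_int k s - circle_int k s0) <= eps.
Proof.
  intros Hs0 Hk eps He; assert (TP := two_PI_pos).
  set (e := eps / (4 * (2 * PI))).
  assert (He' : 0 < e) by (apply Rdiv_lt_0_compat; lra).
  assert (CR : forall t, 0 <= t <= 2 * PI ->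
    continuity_2d_pt (fun s t => Re (k (circle_pt s t))) s0 t).
  { intros t _ eta.
    destruct (continuity_2d_circle_pt k s0 t) with (eps := pos eta) as [d Hd].
    { apply Hk; rewrite Cmod_circle_pt; lra. }
    { apply cond_pos. }
    exists d; intros u v Hu Hv; eapply Rle_lt_trans; [| apply (Hd u v Hu Hv)].
    eapply Rle_trans; [| apply re_le_Cmod]; apply Req_le; reflexivity. }
  assert (CI : forall t, 0 <= t <= 2 * PI ->
    continuity_2d_pt (fun s t => Im (k (circle_pt s t))) s0 t).
  { intros t _ eta.
    destruct (continuity_2d_circle_pt k s0 t) with (eps := pos eta) as [d Hd].
    { apply Hk; rewrite Cmod_circle_pt; lra. }
    { apply cond_pos. }
    exists d; intros u v Hu Hv; eapply Rle_lt_trans; [| apply (Hd u v Hu Hv)].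
    eapply Rle_trans; [| apply im_le_Cmod]; apply Req_le; reflexivity. }
  destruct (uniform_continuity_2d_1d' _ _ _ _ CR (mkposreal e He')) as [d1 D1].
  destruct (uniform_continuity_2d_1d' _ _ _ _ CI (mkposreal e He')) as [d2 D2].
  exists (Rmin d1 d2); split; [apply Rmin_glb_lt; apply cond_pos |].
  intros s Hs Hd; apply Rmin_Rgt_l in Hd as [Hd1 Hd2].
  apply Rabs_lt_between in Hd1; apply Rabs_lt_between in Hd2.
  assert (P1 := cond_pos d1); assert (P2 := cond_pos d2).
  unfold circle_int; rewrite <- C_RInt_minus; try lra;
    try (apply Rcont_on_circle; [lra |]; intros z Hz; apply Hk; lra).
  apply Rle_trans with ((2 * PI - 0) * (2 * e)).
  2: { unfold e; apply Rle_trans with (eps / 2); [| lra]; apply Req_le; field.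
       apply PI_neq0. }
  apply Cmod_C_RInt_le; [lra | |].
  - intros t Ht.
    assert (K1 : Rcont_on (fun t => k (circle_pt s t)) 0 (2 * PI))
      by (apply Rcont_on_circle; [lra |]; intros z Hz; apply Hk; lra).
    assert (K2 : Rcont_on (fun t => k (circle_pt s0 t)) 0 (2 * PI))
      by (apply Rcont_on_circle; [lra |]; intros z Hz; apply Hk; lra).
    apply Rcont_minus;
      [apply K1 | apply K2]; auto.
  - intros t Ht.
    specialize (D1 t s0 t s Ht ltac:(lra) Ht ltac:(lra)).
    specialize (D2 t s0 t s Ht ltac:(lra) Ht ltac:(lra)).
    rewrite Rminus_diag, Rabs_R0 in D1, D2.
    specialize (D1 P1); specialize (D2 P2); simpl in D1, D2.
    eapply Rle_trans; [apply Cmod_le_Re_Im |]; simpl.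
    unfold Re, Im, Rminus in *; lra.
Qed.

Lemma circle_int_0 (k : C -> C) : circle_int k 0 = (2 * PI * k 0)%C.
Proof.
  unfold circle_int; rewrite (C_RInt_ext _ (fun _ => k 0)).
  - rewrite C_RInt_const.
    apply injective_projections; simpl; ring.
  - assert (T := two_PI_pos); lra.
  - intros t _; f_equal; unfold circle_pt; apply injective_projections; simpl; ring.
Qed.

(** The integral does not depend on the radius on either side of [s0], and it is
    continuous in the radius, so the circle of radius [s0] may contain points at
    which [k] is merely continuous.  This is what makes the difference quotient
    in Cauchy's formula accessible without a removable singularity theorem. *)
Lemma circle_int_mean_value (k : C -> C) (R0 s0 : R) :
  (forall z, Cmod z < R0 -> Ccont k z) ->
  (forall z, Cmod z < R0 -> Cmod z <> s0 -> exists l, Cdiff k z l) ->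
  forall s, 0 <= s < R0 -> circle_int k s = (2 * PI * k 0)%C.
Proof.
  intros Hc Hd.
  assert (Seg : forall a b, 0 <= a <= b -> b < R0 -> (s0 <= a \/ b <= s0) ->
    circle_int k a = circle_int k b).
  { intros a b Hab Hb Hs0.
    destruct (Req_dec a b) as [-> | N]; [reflexivity |].
    set (m := (a + b) / 2).
    assert (Inner : forall u v, a < u <= v -> v < b -> circle_int k u = circle_int k v).
    { intros u v Hu Hv; apply circle_int_constant; [lra |].
      intros z Hz; apply Hd; lra. }
    transitivity (circle_int k m); apply Ceq_of_small; intros eps He.
    - destruct (circle_int_continuous k R0 a ltac:(lra) Hc eps He) as [d [Hd0 Hd1]].
      set (s := Rmin m (a + d / 2)).
      assert (S1 := Rmin_l m (a + d / 2)); assert (S2 := Rmin_r m (a + d / 2)); fold s in S1, S2.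
      assert (S3 : a < s) by (apply Rmin_glb_lt; unfold m; lra).
      rewrite <- (Inner s m) by (unfold m in *; lra).
      rewrite Cmod_minus_sym; apply Hd1; [unfold m in *; lra |].
      apply Rabs_lt_between; lra.
    - destruct (circle_int_continuous k R0 b ltac:(lra) Hc eps He) as [d [Hd0 Hd1]].
      set (s := Rmax m (b - d / 2)).
      assert (S1 := Rmax_l m (b - d / 2)); assert (S2 := Rmax_r m (b - d / 2)); fold s in S1, S2.
      assert (S3 : s < b) by (apply Rmax_lub_lt; unfold m; lra).
      rewrite (Inner m s) by (unfold m in *; lra).
      apply Hd1; [unfold m in *; lra |].
      apply Rabs_lt_between; lra. }
  intros s Hs; rewrite <- circle_int_0.
  destruct (Rle_dec s s0) as [H | H]; [symmetry; apply Seg; lra |].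
  destruct (Rle_dec s0 0) as [H' | H']; [symmetry; apply Seg; lra |].
  transitivity (circle_int k s0); symmetry; apply Seg; lra.
Qed.

Lemma Cmod_minus_pos (w z : C) : w <> z -> 0 < Cmod (w - z).
Proof.
  intros N; apply Cmod_gt_0; intros E; apply N.
  replace w with ((w - z) + z)%C by ring; rewrite E; ring.
Qed.

Lemma circle_neq (w z : C) (r : R) : Cmod z < r -> Cmod w = r -> (w - z)%C <> 0.
Proof.
  intros Hz Hw; apply Cmod_gt_0; assert (T := Cmod_minus_ge w z); lra.
Qed.

Lemma Cdiff_Cauchy_kernel (z w : C) : (w - z)%C <> 0 ->
  exists l, Cdiff (fun w => / (w - z))%C w l.
Proof.
  intros H; eexists; apply (Cdiff_inv (fun w => w - z)%C); [exact H |].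
  apply Cdiff_minus; [apply Cdiff_id | apply Cdiff_const].
Qed.

Lemma circle_int_ext (f g : C -> C) (r : R) : 0 <= r ->
  (forall w, Cmod w = r -> f w = g w) -> circle_int f r = circle_int g r.
Proof.
  intros Hr E; assert (T := two_PI_pos); apply C_RInt_ext; [lra |]; intros t _.
  apply E, Cmod_circle_pt, Hr.
Qed.

Lemma circle_int_minus (f g : C -> C) (r : R) : 0 <= r ->
  (forall w, Cmod w = r -> Ccont f w) -> (forall w, Cmod w = r -> Ccont g w) ->
  circle_int (fun w => f w - g w)%C r = (circle_int f r - circle_int g r)%C.
Proof.
  intros Hr Hf Hg; assert (T := two_PI_pos).
  apply C_RInt_minus; [lra | |]; apply Rcont_on_circle; auto.
Qed.

Lemma circle_int_scal (c : C) (f : C -> C) (r : R) : 0 <= r ->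
  (forall w, Cmod w = r -> Ccont f w) ->
  circle_int (fun w => c * f w)%C r = (c * circle_int f r)%C.
Proof.
  intros Hr Hf; assert (T := two_PI_pos).
  apply C_RInt_scal; [lra |]; apply Rcont_on_circle; auto.
Qed.

Lemma Cmod_circle_int_le (f : C -> C) (r M : R) : 0 <= r ->
  (forall w, Cmod w = r -> Ccont f w) ->
  (forall w, Cmod w = r -> Cmod (f w) <= M) -> Cmod (circle_int f r) <= 2 * PI * M.
Proof.
  intros Hr Hf HM; assert (T := two_PI_pos).
  replace (2 * PI * M) with ((2 * PI - 0) * M) by ring.
  apply Cmod_C_RInt_le; [lra | apply Rcont_on_circle; auto |].
  intros t _; apply HM, Cmod_circle_pt, Hr.
Qed.

(** The integrand is holomorphic outside the circle and tends to [1] at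
    infinity, so the radius can be sent to infinity. *)
Lemma circle_int_Cauchy_kernel (z : C) (r : R) : Cmod z < r ->
  circle_int (fun w => w * / (w - z))%C r = (2 * PI)%R.
Proof.
  intros Hz; assert (Hz0 := Cmod_ge_0 z); assert (TP := two_PI_pos).
  assert (Diff : forall w, r <= Cmod w -> exists l, Cdiff (fun w => w * / (w - z))%C w l).
  { intros w Hw; destruct (Cdiff_Cauchy_kernel z w) as [l Hl].
    - apply (circle_neq w z (Cmod w)); lra.
    - eexists; apply (Cdiff_mult (fun w => w)); [apply Cdiff_id | exact Hl]. }
  apply Ceq_of_small; intros eps He.
  set (x := 2 * PI * (Cmod z + 1) / eps).
  assert (Hx : 0 < x) by (apply Rdiv_lt_0_compat; [apply Rmult_lt_0_compat |]; lra).
  rewrite (circle_int_constant _ r (r + x)) by (try lra; intros w Hw; apply Diff; lra).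
  replace (RtoC (2 * PI)) with (circle_int (fun _ => 1) (r + x)).
  2: { unfold circle_int; rewrite C_RInt_const; apply injective_projections; simpl; ring. }
  assert (Cc : forall w, Ccont (fun _ => RtoC 1) w) by (intros w; apply Ccont_const).
  assert (Ck : forall w, Cmod w = r + x -> Ccont (fun w => w * / (w - z))%C w).
  { intros w Hw; destruct (Diff w) as [l Hl]; [lra |]; eapply Cdiff_Ccont; eauto. }
  rewrite <- circle_int_minus by (try lra; auto).
  eapply Rle_trans; [apply (Cmod_circle_int_le _ _ (eps / (2 * PI))) |].
  - lra.
  - intros w Hw; apply Ccont_minus;
      [apply Ck, Hw | apply Cc].
  - intros w Hw.
    assert (N : (w - z)%C <> 0) by (apply (circle_neq w z (r + x)); lra).
    replace (w * / (w - z) - 1)%C with (z / (w - z))%C by (field; exact N).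
    rewrite Cmod_div by exact N.
    assert (T := Cmod_minus_ge w z).
    apply Rle_div_l; [lra |].
    apply Rle_trans with (eps / (2 * PI) * x).
    + unfold x; apply Rle_trans with (Cmod z + 1); [lra |].
      apply Req_le; field; lra.
    + apply Rmult_le_compat_l; [| lra].
      apply Rlt_le, Rdiv_lt_0_compat; lra.
  - apply Req_le; field; lra.
Qed.

(** The mean value property for [w * (f w - f z) / (w - z)], which vanishes at
    the origin and is continuous at [z]. *)
Lemma Cauchy_formula (f : C -> C) (R0 r : R) (z : C) :
  (forall w, Cmod w < R0 -> exists l, Cdiff f w l) ->
  Cmod z < r < R0 ->
  circle_int (fun w => f w * w * / (w - z))%C r = (2 * PI * f z)%C.
Proof.
  intros Hf Hr; assert (Hz0 := Cmod_ge_0 z).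
  destruct (Hf z ltac:(lra)) as [l0 Hl0].
  set (k := fun w : C => if excluded_middle_informative (w = z) then (z * l0)%C
              else (w * ((f w - f z) / (w - z)))%C).
  assert (kz : k z = (z * l0)%C)
    by (unfold k; destruct (excluded_middle_informative (z = z)); tauto).
  assert (kw : forall w, w <> z -> k w = (w * ((f w - f z) / (w - z)))%C)
    by (intros w N; unfold k; destruct (excluded_middle_informative (w = z)); tauto).
  assert (k0 : k 0 = 0).
  { destruct (excluded_middle_informative (RtoC 0 = z)) as [E | N].
    - rewrite E, kz, <- E; ring.
    - rewrite kw by exact N; ring. }
  assert (sub : forall w, w <> z -> (w - z)%C <> 0).
  { intros w N; apply Cmod_gt_0, Cmod_minus_pos, N. }
  assert (Dk : forall w, Cmod w < R0 -> w <> z -> exists l, Cdiff k w l).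
  { intros w Hw N; destruct (Hf w Hw) as [l Hl]; eexists.
    apply (Cdiff_ext_loc (fun w => w * ((f w - f z) / (w - z)))%C _ _ _ (Cmod (w - z))).
    - apply Cmod_minus_pos, N.
    - intros v Hv; symmetry; apply kw; intros ->.
      rewrite Cmod_minus_sym in Hv; lra.
    - apply (Cdiff_mult (fun w => w)); [apply Cdiff_id |].
      apply (Cdiff_div (fun w => f w - f z)%C (fun w => w - z)%C).
      + apply sub, N.
      + apply Cdiff_minus; [exact Hl | apply Cdiff_const].
      + apply Cdiff_minus; [apply Cdiff_id | apply Cdiff_const]. }
  assert (Ck : forall w, Cmod w < R0 -> Ccont k w).
  { intros w Hw; destruct (excluded_middle_informative (w = z)) as [-> | N].
    2: { destruct (Dk w Hw N) as [l Hl]; eapply Cdiff_Ccont, Hl. }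
    apply Ccont_eps; intros eps He; rewrite kz.
    set (e1 := eps / (2 * (Cmod z + 1))); set (e2 := eps / (2 * (Cmod l0 + 1))).
    assert (Hl00 := Cmod_ge_0 l0).
    assert (He1 : 0 < e1) by (apply Rdiv_lt_0_compat; lra).
    assert (He2 : 0 < e2) by (apply Rdiv_lt_0_compat; lra).
    assert (E1 : (Cmod z + 1) * e1 = eps / 2) by (unfold e1; field; lra).
    assert (E2 : (Cmod l0 + 1) * e2 = eps / 2) by (unfold e2; field; lra).
    destruct (proj1 (Cdiff_eps _ _ _) Hl0 e1 He1) as [d [Hd Hd']].
    exists (Rmin (Rmin d 1) e2); split; [repeat apply Rmin_glb_lt; lra |].
    intros w Hwd; apply Rmin_Rgt_l in Hwd as [W W3]; apply Rmin_Rgt_l in W as [W1 W2].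
    destruct (excluded_middle_informative (w = z)) as [-> | N].
    { rewrite kz; replace (z * l0 - z * l0)%C with (RtoC 0) by ring; rewrite Cmod_0; exact He. }
    rewrite kw by exact N.
    assert (Hp := Cmod_minus_pos w z N).
    replace (w * ((f w - f z) / (w - z)) - z * l0)%C
      with (w * ((f w - f z - l0 * (w - z)) / (w - z)) + (w - z) * l0)%C
      by (field; apply sub, N).
    eapply Rle_lt_trans; [apply Cmod_triangle |].
    rewrite !Cmod_mult, Cmod_div by (apply sub, N).
    assert (Q : Cmod (f w - f z - l0 * (w - z)) / Cmod (w - z) <= e1)
      by (apply Rle_div_l; [exact Hp | apply Hd', W1]).
    assert (Q0 : 0 <= Cmod (f w - f z - l0 * (w - z)) / Cmod (w - z)).
    { apply Rle_div_r; [exact Hp |]; rewrite Rmult_0_l; apply Cmod_ge_0. }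
    assert (Wz : Cmod w <= Cmod z + 1) by (assert (T := Cmod_minus_ge w z); lra).
    assert (Hw0 := Cmod_ge_0 w).
    assert (A1 : Cmod w * (Cmod (f w - f z - l0 * (w - z)) / Cmod (w - z)) <= (Cmod z + 1) * e1)
      by (apply Rmult_le_compat; lra).
    assert (A2 : Cmod (w - z) * Cmod l0 <= e2 * Cmod l0)
      by (apply Rmult_le_compat_r; lra).
    lra. }
  assert (K := circle_int_mean_value k R0 (Cmod z) Ck).
  assert (K' : circle_int k r = (2 * PI * k 0)%C).
  { apply K; [| lra]; intros w Hw N; apply Dk; [exact Hw | congruence]. }
  rewrite k0 in K'.
  assert (Dker : forall w, Cmod w = r -> exists l, Cdiff (fun w => / (w - z))%C w l).
  { intros w Hw; apply Cdiff_Cauchy_kernel, (circle_neq w z r); lra. }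
  assert (C1 : forall w, Cmod w = r -> Ccont (fun w => f w * w * / (w - z))%C w).
  { intros w Hw; destruct (Dker w Hw) as [l Hl]; destruct (Hf w ltac:(lra)) as [m Hm].
    eapply Cdiff_Ccont; apply (Cdiff_mult (fun w => f w * w)%C); [| exact Hl].
    apply Cdiff_mult; [exact Hm | apply Cdiff_id]. }
  assert (C2 : forall w, Cmod w = r -> Ccont (fun w => w * / (w - z))%C w).
  { intros w Hw; destruct (Dker w Hw) as [l Hl].
    eapply Cdiff_Ccont; apply (Cdiff_mult (fun w => w)); [apply Cdiff_id | exact Hl]. }
  assert (C3 : forall w, Cmod w = r -> Ccont (fun w => f z * (w * / (w - z)))%C w).
  { intros w Hw; apply Ccont_scal, C2, Hw. }
  rewrite (circle_int_ext k (fun w => f w * w * / (w - z) - f z * (w * / (w - z)))%C) in K'.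
  - rewrite circle_int_minus in K' by (try lra; auto).
    rewrite circle_int_scal in K' by (try lra; auto).
    rewrite circle_int_Cauchy_kernel in K' by lra.
    replace (circle_int (fun w => f w * w * / (w - z))%C r) with
      ((circle_int (fun w => f w * w * / (w - z))%C r - f z * (2 * PI)%R) + f z * (2 * PI)%R)%C
      by ring.
    rewrite K'; apply injective_projections; simpl; ring.
  - lra.
  - intros w Hw; rewrite kw; [field; apply (circle_neq w z r); lra |].
    intros ->; lra.
Qed.

(** * Derivatives of holomorphic functions *)

Lemma Ccont_circle_bounded (f : C -> C) (r : R) : 0 <= r ->
  (forall w, Cmod w = r -> Ccont f w) ->
  exists M, 0 < M /\ forall t, 0 <= t <= 2 * PI -> Cmod (f (circle_pt r t)) <= M.
Proof.
  intros Hr Hf; assert (TP := two_PI_pos).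
  destruct (continuity_ab_maj (fun t => Cmod (f (circle_pt r t))) 0 (2 * PI)) as [t0 [Ht0 _]].
  - lra.
  - intros t Ht; apply continuity_pt_filterlim, filterlim_locally; intros eps.
    destruct (proj1 (Rcont_eps _ _) (Rcont_on_circle f r Hr Hf t Ht) eps (cond_pos eps)) as [d [Hd H]].
    exists (mkposreal d Hd); intros s Hs; specialize (H s Hs).
    assert (T1 := Cmod_minus_ge (f (circle_pt r s)) (f (circle_pt r t))).
    assert (T2 := Cmod_minus_ge (f (circle_pt r t)) (f (circle_pt r s))).
    rewrite (Cmod_minus_sym (f (circle_pt r t))) in T2.
    apply Rabs_lt_between; unfold minus, plus, opp; simpl; lra.
  - exists (Cmod (f (circle_pt r t0)) + 1); split.
    + assert (T := Cmod_ge_0 (f (circle_pt r t0))); lra.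
    + intros t Ht; specialize (Ht0 t Ht); lra.
Qed.

(** Differentiation under the integral sign, for kernels whose first-order
    expansion in the parameter has a uniform quadratic remainder. *)
Lemma Cdiff_circle_int (K : C -> C -> C) (K1 : C -> C) (r : R) (z : C) (d M : R) :
  0 <= r -> 0 < d -> 0 < M ->
  (forall w v, Cmod (w - z) < d -> Cmod v = r -> Ccont (K w) v) ->
  (forall v, Cmod v = r -> Ccont K1 v) ->
  (forall w t, Cmod (w - z) < d -> 0 <= t <= 2 * PI ->
     Cmod (K w (circle_pt r t) - K z (circle_pt r t) - (w - z) * K1 (circle_pt r t))
     <= M * (Cmod (w - z) * Cmod (w - z))) ->
  Cdiff (fun w => circle_int (K w) r) z (circle_int K1 r).
Proof.
  intros Hr Hd HM HK HK1 Hb; assert (TP := two_PI_pos).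
  apply Cdiff_eps; intros eps He.
  assert (HP : 0 < 2 * PI * M) by (apply Rmult_lt_0_compat; lra).
  exists (Rmin d (eps / (2 * PI * M))); split.
  { apply Rmin_glb_lt; [lra | apply Rdiv_lt_0_compat; lra]. }
  intros w Hw; apply Rmin_Rgt_l in Hw as [W1 W2].
  assert (Cz : forall v, Cmod v = r -> Ccont (K z) v).
  { intros v; apply HK; replace (z - z)%C with (RtoC 0) by ring; rewrite Cmod_0; lra. }
  assert (Cw : forall v, Cmod v = r -> Ccont (K w) v) by (intros v; apply HK, W1).
  assert (Cwz : forall v, Cmod v = r -> Ccont (fun v => K w v - K z v)%C v).
  { intros v Hv; apply Ccont_minus;
      [apply Cw | apply Cz]; exact Hv. }
  assert (C1 : forall v, Cmod v = r -> Ccont (fun v => (w - z) * K1 v)%C v).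
  { intros v Hv; apply Ccont_scal, HK1, Hv. }
  rewrite (Cmult_comm (circle_int K1 r)), <- circle_int_scal by auto.
  rewrite <- circle_int_minus, <- circle_int_minus by auto.
  set (D := Cmod (w - z)) in *.
  apply Rle_trans with ((2 * PI - 0) * (M * (D * D))).
  - unfold circle_int; apply Cmod_C_RInt_le; [lra | |].
    + apply (Rcont_on_circle (fun v => K w v - K z v - (w - z) * K1 v)%C); [exact Hr |].
      intros v Hv; apply Ccont_minus;
        [apply Cwz | apply C1]; exact Hv.
    + intros t Ht; apply Hb; auto.
  - apply Rlt_div_r in W2; [| exact HP].
    assert (0 <= D) by apply Cmod_ge_0; nra.
Qed.

(** With [u = 1 / (v - z)], [u' = 1 / (v - w)] and [h = w - z] one has
    [u' - u = h u u'], hence [u' - u - h u^2 = h^2 u^2 u'] and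
    [u'^2 - u^2 - 2 h u^3 = h^2 u^2 u' (u' + 2 u)]: the quadratic remainders. *)
Lemma Cdiff_Cauchy_integral (f : C -> C) (r : R) (z : C) : Cmod z < r ->
  (forall w, Cmod w = r -> Ccont f w) ->
  Cdiff (fun z => circle_int (fun w => f w * / (w - z))%C r) z
    (circle_int (fun w => f w * (/ (w - z) * / (w - z)))%C r)
  /\ exists l, Cdiff (fun z => circle_int (fun w => f w * (/ (w - z) * / (w - z)))%C r) z l.
Proof.
  intros Hz Hf; assert (Hz0 := Cmod_ge_0 z).
  assert (Hr : 0 <= r) by lra.
  destruct (Ccont_circle_bounded f r Hr Hf) as [M [HM Hb]].
  set (e := (r - Cmod z) / 2); assert (He : 0 < e) by (unfold e; lra).
  assert (Ck : forall w v, Cmod w < r -> Cmod v = r -> Ccont (fun v => / (v - w))%C v).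
  { intros w v Hw Hv; destruct (Cdiff_Cauchy_kernel w v) as [l Hl].
    - apply (circle_neq v w r); auto.
    - eapply Cdiff_Ccont, Hl. }
  assert (Near : forall w, Cmod (w - z) < e -> Cmod w < r).
  { intros w Hw; assert (T := Cmod_minus_ge w z); unfold e in Hw; lra. }
  assert (Inv : forall w v, Cmod (w - z) < e -> Cmod v = r ->
    (v - w)%C <> 0 /\ Cmod (/ (v - w)) <= / e).
  { intros w v Hw Hv.
    assert (N : (v - w)%C <> 0) by (apply (circle_neq v w r); auto).
    split; [exact N |].
    rewrite Cmod_inv by exact N; apply Rinv_le_contravar; [exact He |].
    assert (T := Cmod_minus_ge v w); assert (T' := Cmod_minus_ge w z); unfold e in *; lra. }
  assert (Hzz : Cmod (z - z) < e)
    by (replace (z - z)%C with (RtoC 0) by ring; rewrite Cmod_0; exact He).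
  assert (Ie : 0 < / e) by (apply Rinv_0_lt_compat, He).
  split.
  - apply (Cdiff_circle_int (fun z w => f w * / (w - z))%C _ r z e (M * (/ e * / e * / e)));
      [exact Hr | exact He | | | |].
    + apply Rmult_lt_0_compat; [exact HM |]; repeat apply Rmult_lt_0_compat; auto.
    + intros w v Hw Hv; apply Ccont_mult; [apply Hf, Hv | apply Ck; auto].
    + intros v Hv; apply Ccont_mult; [apply Hf, Hv | apply Ccont_mult; apply Ck; auto].
    + intros w t Hw Ht; set (v := circle_pt r t).
      assert (Hv : Cmod v = r) by (apply Cmod_circle_pt, Hr).
      destruct (Inv w v Hw Hv) as [N1 B1]; destruct (Inv z v Hzz Hv) as [N2 B2].
      replace (f v * / (v - w) - f v * / (v - z)
                - (w - z) * (f v * (/ (v - z) * / (v - z))))%C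
        with (f v * (/ (v - z) * / (v - z) * / (v - w)) * ((w - z) * (w - z)))%C
        by (field; auto).
      rewrite !Cmod_mult.
      apply Rmult_le_compat_r; [apply Rmult_le_pos; apply Cmod_ge_0 |].
      specialize (Hb t Ht); fold v in Hb.
      repeat apply Rmult_le_compat; repeat apply Rmult_le_pos; auto; apply Cmod_ge_0.
  - exists (circle_int (fun w => f w * (2 * (/ (w - z) * / (w - z) * / (w - z))))%C r).
    apply (Cdiff_circle_int (fun z w => f w * (/ (w - z) * / (w - z)))%C _ r z e
      (M * (/ e * / e * / e * (3 * / e))));
      [exact Hr | exact He | | | |].
    + apply Rmult_lt_0_compat; [exact HM |]; repeat apply Rmult_lt_0_compat; auto; lra.
    + intros w v Hw Hv; apply Ccont_mult; [apply Hf, Hv | apply Ccont_mult; apply Ck; auto].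
    + intros v Hv; apply Ccont_mult; [apply Hf, Hv |].
      apply Ccont_scal; apply Ccont_mult; [apply Ccont_mult |]; apply Ck; auto.
    + intros w t Hw Ht; set (v := circle_pt r t).
      assert (Hv : Cmod v = r) by (apply Cmod_circle_pt, Hr).
      destruct (Inv w v Hw Hv) as [N1 B1]; destruct (Inv z v Hzz Hv) as [N2 B2].
      replace (f v * (/ (v - w) * / (v - w)) - f v * (/ (v - z) * / (v - z))
                - (w - z) * (f v * (2 * (/ (v - z) * / (v - z) * / (v - z)))))%C
        with (f v * (/ (v - z) * / (v - z) * / (v - w) * (/ (v - w) + 2 * / (v - z)))
              * ((w - z) * (w - z)))%C
        by (field; auto).
      rewrite !Cmod_mult.
      apply Rmult_le_compat_r; [apply Rmult_le_pos; apply Cmod_ge_0 |].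
      specialize (Hb t Ht); fold v in Hb.
      assert (B3 : Cmod (/ (v - w) + 2 * / (v - z)) <= 3 * / e).
      { eapply Rle_trans; [apply Cmod_triangle |].
        rewrite Cmod_mult, Cmod_R, Rabs_pos_eq by lra; lra. }
      repeat apply Rmult_le_compat; repeat apply Rmult_le_pos; auto; apply Cmod_ge_0.
Qed.

(** Near each point, Cauchy's formula makes [f'] a Cauchy integral with a squared
    kernel, which can be differentiated once more. *)
Theorem Cdiff_derivative_again (f f' : C -> C) (R0 : R) :
  (forall z, Cmod z < R0 -> Cdiff f z (f' z)) ->
  forall z, Cmod z < R0 -> exists l, Cdiff f' z l.
Proof.
  intros Hf z Hz; assert (TP := two_PI_pos); assert (Hz0 := Cmod_ge_0 z).
  set (r := (Cmod z + R0) / 2).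
  assert (Hr : Cmod z < r < R0) by (unfold r; lra).
  assert (P0 : (2 * PI)%C <> 0).
  { intros E; apply (f_equal fst) in E; simpl in E; lra. }
  set (h := fun w => (f w * w)%C).
  assert (Ch : forall w, Cmod w = r -> Ccont h w).
  { intros w Hw; eapply Cdiff_Ccont; apply Cdiff_mult; [apply Hf; lra | apply Cdiff_id]. }
  set (F2 := fun z => circle_int (fun w => h w * (/ (w - z) * / (w - z)))%C r).
  assert (E : forall w, Cmod w < r -> f' w = (/ (2 * PI) * F2 w)%C).
  { intros w Hw; apply (Cdiff_unique f w); [apply Hf; lra |].
    apply (Cdiff_ext_loc (fun z => / (2 * PI) * circle_int (fun w => h w * / (w - z)) r)%C
             _ _ _ (r - Cmod w)); [lra | |].
    - intros u Hu; assert (T := Cmod_minus_ge u w).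
      unfold h; rewrite (Cauchy_formula f R0 r u);
        [rewrite Cmult_assoc, Cinv_l by exact P0; ring | | lra].
      intros v Hv; eexists; apply Hf, Hv.
    - replace (/ (2 * PI) * F2 w)%C
        with (0 * circle_int (fun v => h v * / (v - w))%C r + / (2 * PI) * F2 w)%C by ring.
      apply (Cdiff_mult (fun _ => / (2 * PI))%C); [apply Cdiff_const |].
      apply Cdiff_Cauchy_integral; auto. }
  destruct (proj2 (Cdiff_Cauchy_integral h r z ltac:(lra) Ch)) as [l Hl]; fold F2 in Hl.
  eexists.
  apply (Cdiff_ext_loc (fun w => / (2 * PI) * F2 w)%C _ _ _ (r - Cmod z)); [lra | |].
  - intros w Hw; assert (T := Cmod_minus_ge w z); symmetry; apply E; lra.
  - apply (Cdiff_mult (fun _ => / (2 * PI))%C); [apply Cdiff_const | exact Hl].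
Qed.

(** * Points of maximum modulus *)

(** Without a maximum, each point of the disk is beaten by some other point of
    the disk, uniformly on a neighbourhood.  By bisection a single point then
    beats the whole disk, itself included. *)
Lemma Cmod_max_on_disk (G : C -> C) (r : R) : 0 <= r ->
  (forall z, Cmod z <= r -> Ccont G z) ->
  exists z0, Cmod z0 <= r /\ forall z, Cmod z <= r -> Cmod (G z) <= Cmod (G z0).
Proof.
  intros Hr HG; apply NNPP; intros Hno.
  assert (Hstrict : forall z0, Cmod z0 <= r ->
    exists z, Cmod z <= r /\ Cmod (G z0) < Cmod (G z)).
  { intros z0 H0; apply NNPP; intros H; apply Hno; exists z0; split; [exact H0 |].
    intros z Hz; apply Rnot_lt_le; intros Hlt; apply H; exists z; auto. }
  set (P := fun a c q => exists z1, Cmod z1 <= r /\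
    forall x y, a <= x <= a + q * (2 * r) -> c <= y <= c + q * (2 * r) ->
      Cmod (x, y) <= r -> Cmod (G (x, y)) < Cmod (G z1)).
  assert (HP : P (- r) (- r) 1).
  { apply (bisection P _ _ (2 * r) (2 * r)); try lra; unfold P.
    - intros a c q Hq [z1 [I1 H1]] [z2 [I2 H2]] [z3 [I3 H3]] [z4 [I4 H4]].
      assert (M2 : forall u v, Cmod u <= r -> Cmod v <= r -> exists z, Cmod z <= r /\
        Cmod (G u) <= Cmod (G z) /\ Cmod (G v) <= Cmod (G z)).
      { intros u v Hu Hv; destruct (Rle_dec (Cmod (G u)) (Cmod (G v)));
          [exists v | exists u]; repeat split; auto; lra. }
      destruct (M2 z1 z2 I1 I2) as [u [Iu [U1 U2]]].
      destruct (M2 z3 z4 I3 I4) as [v [Iv [V1 V2]]].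
      destruct (M2 u v Iu Iv) as [z [Iz [W1 W2]]].
      exists z; split; [exact Iz |]; intros x y Hx Hy Hxy.
      destruct (Rle_dec x (a + q / 2 * (2 * r))) as [X | X];
        destruct (Rle_dec y (c + q / 2 * (2 * r))) as [Y | Y].
      + specialize (H1 x y ltac:(lra) ltac:(lra) Hxy); lra.
      + specialize (H3 x y ltac:(lra) ltac:(lra) Hxy); lra.
      + specialize (H2 x y ltac:(lra) ltac:(lra) Hxy); lra.
      + specialize (H4 x y ltac:(lra) ltac:(lra) Hxy); lra.
    - intros x y _ _.
      assert (Hloc : exists z1 d, Cmod z1 <= r /\ 0 < d /\ forall w,
        Cmod (w - (x, y)) < d -> Cmod w <= r -> Cmod (G w) < Cmod (G z1)).
      { destruct (Rle_dec (Cmod (x, y)) r) as [I | I].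
        - destruct (Hstrict _ I) as [z1 [I1 H1]].
          destruct (proj1 (Ccont_eps _ _) (HG _ I) (Cmod (G z1) - Cmod (G (x, y)))
                      ltac:(lra)) as [d [Hd Hw]].
          exists z1, d; repeat split; auto; intros w W _; specialize (Hw w W).
          assert (T := Cmod_minus_ge (G w) (G (x, y))); lra.
        - exists 0, (Cmod (x, y) - r); rewrite Cmod_0; repeat split; try lra.
          intros w W W'; rewrite Cmod_minus_sym in W.
          assert (T := Cmod_minus_ge (x, y) w); lra. }
      destruct Hloc as [z1 [d [I1 [Hd Hw]]]].
      exists (d / (4 * r + 1)); split; [apply Rdiv_lt_0_compat; lra |].
      intros a c q [Hq0 Hq] Hxa Hyc.
      apply Rlt_div_r in Hq; [| lra].
      exists z1; split; [exact I1 |]; intros u v Hu Hv Huv; apply Hw; [| exact Huv].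
      eapply Rle_lt_trans; [apply Cmod_le_Re_Im |]; simpl.
      apply Rle_lt_trans with (q * (2 * r) + q * (2 * r)); [| lra].
      apply Rplus_le_compat; apply Rabs_le_between; lra. }
  destruct HP as [z1 [I1 H1]].
  assert (B1 := re_le_Cmod z1); assert (B2 := im_le_Cmod z1).
  apply Rabs_le_between in B1; apply Rabs_le_between in B2.
  destruct z1 as [x y]; simpl in B1, B2.
  specialize (H1 x y ltac:(lra) ltac:(lra) I1); lra.
Qed.

Lemma is_derive_of_expansion (f : R -> R) (x l : R) :
  (forall eps, 0 < eps -> exists d, 0 < d /\
    forall h, Rabs h < d -> Rabs (f (x + h) - f x - l * h) <= eps * Rabs h) ->
  is_derive f x l.
Proof.
  intros H; split; [apply is_linear_scal_l |].
  intros y Hy; apply (@is_filter_lim_locally_unique R_AbsRing R_NormedModule) in Hy; subst y.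
  intros eps; destruct (H eps (cond_pos eps)) as [d [Hd Hf]].
  exists (mkposreal d Hd); intros s Hs; specialize (Hf (s - x) Hs).
  assert (E1 : forall u v : R, v + (u - v) = u) by (intros; ring).
  assert (E2 : forall a b u v : R, a - b - l * (u - v) = a + - b + - ((u + - v) * l))
    by (intros; ring).
  rewrite E1, E2 in Hf; exact Hf.
Qed.

Lemma derive_ge_0_of_left_max (f : R -> R) (l : R) : is_derive f 0 l ->
  (forall x, x <= 0 -> f x <= f 0) -> 0 <= l.
Proof.
  intros Hf Hmax; apply Rnot_lt_le; intros Hl.
  destruct (is_derive_expansion f 0 l Hf (- l / 2) ltac:(lra)) as [d [Hd H]].
  specialize (H (- (d / 2))); specialize (Hmax (- (d / 2)) ltac:(lra)).
  rewrite Rplus_0_l, Rabs_left in H by lra.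
  specialize (H ltac:(lra)); apply Rabs_le_between in H; nra.
Qed.

Lemma second_derivative_test (f f1 : R -> R) (l : R) :
  (forall x, is_derive f x (f1 x)) -> is_derive f1 0 l ->
  (forall x, f x <= f 0) -> l <= 0.
Proof.
  intros Hf Hf1 Hmax.
  assert (Z1 : 0 <= f1 0) by (apply (derive_ge_0_of_left_max f); auto).
  assert (Z2 : 0 <= - f1 0).
  { apply (derive_ge_0_of_left_max (fun x => f (- x))).
    - evar_last; [apply (is_derive_comp f Ropp 0 (f1 (- 0)) (- 1)); [apply Hf | auto_derive; auto; ring] |].
      unfold scal; simpl; unfold mult; simpl; rewrite Ropp_0; ring.
    - intros x _; rewrite Ropp_0; apply Hmax. }
  apply Rnot_lt_le; intros Hl.
  destruct (is_derive_expansion f1 0 l Hf1 (l / 2) ltac:(lra)) as [d [Hd H]].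
  destruct (MVT_cor2 f f1 0 (d / 2)) as [c [E Hc]]; [lra | |].
  - intros x _; apply is_derive_Reals, Hf.
  - specialize (Hmax (d / 2)); specialize (H c).
    rewrite Rplus_0_l, Rabs_pos_eq in H by lra.
    specialize (H ltac:(lra)); apply Rabs_le_between in H.
    assert (0 < f1 c) by nra; nra.
Qed.

Lemma Cdiff_expansion (F : C -> C) (v : C) (x : R) (l : C) : Cdiff F (x * v)%C l ->
  forall eps, 0 < eps -> exists d, 0 < d /\ forall h, Rabs h < d ->
    Cmod (F ((x + h)%R * v)%C - F (x * v)%C - h * (l * v)) <= eps * Rabs h.
Proof.
  intros HF eps He; assert (Hv := Cmod_ge_0 v).
  set (e := eps / (Cmod v + 1)).
  assert (He' : 0 < e) by (apply Rdiv_lt_0_compat; lra).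
  destruct (proj1 (Cdiff_eps _ _ _) HF e He') as [d [Hd H]].
  exists (d / (Cmod v + 1)); split; [apply Rdiv_lt_0_compat; lra |].
  intros h Hh; apply Rlt_div_r in Hh; [| lra].
  assert (A := Rabs_pos h).
  specialize (H ((x + h)%R * v)%C).
  replace ((x + h)%R * v - x * v)%C with (h * v)%C in H by (rewrite RtoC_plus; ring).
  rewrite Cmod_mult, Cmod_R in H.
  replace (h * (l * v))%C with (l * (h * v))%C by ring.
  eapply Rle_trans; [apply H; nra |].
  assert (E : e * (Cmod v + 1) = eps) by (unfold e; field; lra).
  nra.
Qed.

Lemma is_derive_Re_line (F : C -> C) (v : C) (x : R) (l : C) : Cdiff F (x * v)%C l ->
  is_derive (fun s : R => Re (F (s * v)%C)) x (Re (l * v)%C).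
Proof.
  intros HF; apply is_derive_of_expansion; intros eps He.
  destruct (Cdiff_expansion F v x l HF eps He) as [d [Hd H]].
  exists d; split; [exact Hd |]; intros h Hh.
  eapply Rle_trans; [| apply H, Hh]; eapply Rle_trans; [| apply re_le_Cmod].
  apply Req_le; f_equal; unfold Re; simpl; ring.
Qed.

Lemma is_derive_Im_line (F : C -> C) (v : C) (x : R) (l : C) : Cdiff F (x * v)%C l ->
  is_derive (fun s : R => Im (F (s * v)%C)) x (Im (l * v)%C).
Proof.
  intros HF; apply is_derive_of_expansion; intros eps He.
  destruct (Cdiff_expansion F v x l HF eps He) as [d [Hd H]].
  exists d; split; [exact Hd |]; intros h Hh.
  eapply Rle_trans; [| apply H, Hh]; eapply Rle_trans; [| apply im_le_Cmod].
  apply Req_le; f_equal; unfold Im; simpl; ring.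
Qed.

Lemma is_derive_mult_R (f g : R -> R) (x a b : R) : is_derive f x a -> is_derive g x b ->
  is_derive (fun s => f s * g s) x (a * g x + f x * b).
Proof.
  intros Hf Hg; apply (is_derive_mult (K := R_AbsRing) f g x a b Hf Hg), Rmult_comm.
Qed.

Lemma is_derive_plus_R (f g : R -> R) (x a b : R) : is_derive f x a -> is_derive g x b ->
  is_derive (fun s => f s + g s) x (a + b).
Proof. apply (@is_derive_plus R_AbsRing R_NormedModule). Qed.

(** The product rule for the real inner product [Re (Cconj a * b)] along the line
    through the origin with direction [v]. *)
Lemma is_derive_inner_line (F G : C -> C) (v : C) (x : R) (a b : C) :
  Cdiff F (x * v)%C a -> Cdiff G (x * v)%C b ->
  is_derive (fun s : R => Re (Cconj (F (s * v)%C) * G (s * v)%C)%C) x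
    (Re (Cconj (a * v) * G (x * v) + Cconj (F (x * v)) * (b * v))%C).
Proof.
  intros HF HG.
  apply (is_derive_ext (fun s : R => Re (F (s * v)%C) * Re (G (s * v)%C)
                                     + Im (F (s * v)%C) * Im (G (s * v)%C))).
  { intros s; unfold Re, Im, Cconj; simpl; ring. }
  evar_last.
  - exact (is_derive_plus_R _ _ x _ _
      (is_derive_mult_R _ _ x _ _
        (is_derive_Re_line F v x a HF) (is_derive_Re_line G v x b HG))
      (is_derive_mult_R _ _ x _ _
        (is_derive_Im_line F v x a HF) (is_derive_Im_line G v x b HG))).
  - as_R; unfold Re, Im, Cconj; simpl; ring.
Qed.

(** Apply the real mean value theorem to the projection of [p (t * z)] on the
    direction of the increment [p z - p 0]. *)
Lemma mean_value_inequality (p p1 : C -> C) (z : C) (M : R) :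
  (forall t : R, 0 <= t <= 1 -> Cdiff p (t * z)%C (p1 (t * z)%C)) ->
  (forall t : R, 0 <= t <= 1 -> Cmod (p1 (t * z)%C) <= M) ->
  Cmod (p z - p 0) <= Cmod z * M.
Proof.
  intros Hp HM.
  set (c := (p z - p 0)%C).
  destruct (MVT_cor2 (fun t : R => Re (Cconj c * p (t * z))%C)
    (fun t : R => Re (Cconj c * (p1 (t * z) * z))%C) 0 1) as [t [E Ht]].
  - lra.
  - intros t Ht; apply is_derive_Reals.
    evar_last; [apply (is_derive_inner_line (fun _ => c) p z t); [apply Cdiff_const | apply Hp, Ht] |].
    as_R; f_equal; unfold Cconj; apply injective_projections; simpl; ring.
  - specialize (HM t ltac:(lra)).
    replace (1 * z)%C with z in E by ring; replace (0 * z)%C with (RtoC 0) in E by ring.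
    assert (E1 : Re (Cconj c * p z)%C - Re (Cconj c * p 0)%C = Cmod c * Cmod c).
    { assert (T := Cmod2_alt c); unfold c in *; unfold Re, Im, Cconj in *; simpl in *; lra. }
    assert (E2 : Re (Cconj c * (p1 (t * z) * z))%C <= Cmod c * (Cmod z * M)).
    { eapply Rle_trans; [apply Rle_abs |]; eapply Rle_trans; [apply re_le_Cmod |].
      rewrite !Cmod_mult, Cmod_conj.
      apply Rmult_le_compat_l; [apply Cmod_ge_0 |].
      rewrite Rmult_comm; apply Rmult_le_compat_l; [apply Cmod_ge_0 | exact HM]. }
    assert (H0 := Cmod_ge_0 c); assert (Hz := Cmod_ge_0 z).
    assert (HM0 : 0 <= M) by (eapply Rle_trans; [apply Cmod_ge_0 | exact HM]).
    destruct (Req_dec (Cmod c) 0) as [Z | Z]; [rewrite Z; nra |].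
    apply Rmult_le_reg_l with (Cmod c); [lra |].
    lra.
Qed.

(** In the coordinate [t] with [z = z0 * Cexp t], the derivative [d/dt] is the
    operator [z d/dz], and [|G|] has at [t = 0] a maximum over [Re t <= 0].
    Along the negative real axis this makes the first derivative of [|G|^2]
    nonnegative, and along the imaginary axis it makes the second derivative
    nonpositive; up to a factor 2 these are the two inequalities.  The maximum
    may lie inside the disk or at its centre. *)
Lemma max_modulus_conditions (G G1 G2 : C -> C) (R0 r : R) (z0 : C) :
  r < R0 ->
  (forall z, Cmod z < R0 -> Cdiff G z (G1 z)) ->
  (forall z, Cmod z < R0 -> Cdiff G1 z (G2 z)) ->
  Cmod z0 <= r ->
  (forall z, Cmod z <= r -> Cmod (G z) <= Cmod (G z0)) ->
  0 <= Re (Cconj (G z0) * (z0 * G1 z0))%C /\ Cmod (z0 * G1 z0) ^ 2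
    <= Re (Cconj (G z0) * (z0 * G1 z0 + z0 ^ 2 * G2 z0))%C.
Proof.
  intros Hr HG HG1 H0 Hmax.
  set (g := fun t => G (z0 * Cexp t)%C).
  set (g1 := fun t => (z0 * Cexp t * G1 (z0 * Cexp t))%C).
  assert (Hin : forall t, Re t <= 0 -> Cmod (z0 * Cexp t) <= r).
  { intros t Ht; rewrite Cmod_mult, Cmod_Cexp.
    assert (exp (Re t) <= 1).
    { rewrite <- exp_0; destruct Ht as [Ht | ->]; [apply Rlt_le, exp_increasing, Ht | lra]. }
    assert (Hz := Cmod_ge_0 z0); assert (He := exp_pos (Re t)); nra. }
  assert (Dm : forall t, Cdiff (fun t => z0 * Cexp t)%C t (z0 * Cexp t)%C).
  { intros t.
    assert (K := Cdiff_mult (fun _ => z0) Cexp t _ _ (Cdiff_const z0 t) (Cdiff_Cexp t)).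
    cbv beta in K; replace (0 * Cexp t + z0 * Cexp t)%C with (z0 * Cexp t)%C in K by ring.
    exact K. }
  assert (Dg : forall t, Re t <= 0 -> Cdiff g t (g1 t)).
  { intros t Ht; apply (Cdiff_comp G (fun t => z0 * Cexp t)%C); [| apply Dm].
    apply HG; specialize (Hin t Ht); lra. }
  assert (Dg1 : forall t, Re t <= 0 -> Cdiff g1 t
    (z0 * Cexp t * G1 (z0 * Cexp t)
     + z0 * Cexp t * (z0 * Cexp t * G2 (z0 * Cexp t)))%C).
  { intros t Ht; apply (Cdiff_mult (fun t => z0 * Cexp t)%C (fun t => G1 (z0 * Cexp t)%C));
      [apply Dm |].
    apply (Cdiff_comp G1 (fun t => z0 * Cexp t)%C); [| apply Dm].
    apply HG1; specialize (Hin t Ht); lra. }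
  assert (E0 : (z0 * Cexp 0)%C = z0) by (rewrite Cexp_0; ring).
  assert (Hsq : forall t, Re t <= 0 ->
    Re (Cconj (g t) * g t)%C <= Re (Cconj (g 0) * g 0)%C).
  { intros t Ht; rewrite !Re_conj_mult_self; unfold g; rewrite E0.
    apply pow_incr; split; [apply Cmod_ge_0 | apply Hmax, Hin, Ht]. }
  assert (Z1 : (RtoC 0 * 1)%C = 0) by ring.
  assert (Zi : (RtoC 0 * Ci)%C = 0) by ring.
  assert (Ri : forall s : R, Re (s * Ci)%C <= 0) by (intros s; simpl; lra).
  assert (g0 : g 0 = G z0) by (unfold g; rewrite E0; reflexivity).
  assert (g10 : g1 0 = (z0 * G1 z0)%C) by (unfold g1; rewrite E0; reflexivity).
  split.
  - (* radial derivative *)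
    assert (D := is_derive_inner_line g g 1 0 (g1 0) (g1 0)).
    rewrite Z1 in D; specialize (D (Dg 0 ltac:(simpl; lra)) (Dg 0 ltac:(simpl; lra))).
    apply derive_ge_0_of_left_max in D.
    + rewrite g0, g10 in D.
      revert D; generalize (z0 * G1 z0)%C (G z0); intros a b D.
      unfold Re, Cconj in *; simpl in *; lra.
    + intros x Hx; rewrite Z1; apply Hsq; simpl; lra.
  - (* second tangential derivative *)
    assert (D1 : forall s : R, is_derive (fun s : R => Re (Cconj (g (s * Ci)) * g (s * Ci))%C) s
      (2 * Re (Cconj (g (s * Ci)) * ((fun t => g1 t * Ci) (s * Ci)))%C)).
    { intros s; evar_last; [apply (is_derive_inner_line g g Ci s); apply Dg, Ri |].
      as_R; unfold Re, Im, Cconj; simpl; ring. }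
    assert (Dc : Cdiff (fun t => g1 t * Ci)%C (RtoC 0 * Ci)%C
      ((z0 * G1 z0 + z0 * (z0 * G2 z0)) * Ci + g1 (RtoC 0 * Ci)%C * 0)%C).
    { apply (Cdiff_mult g1 (fun _ => Ci)); [| apply Cdiff_const].
      assert (K := Dg1 (RtoC 0 * Ci)%C (Ri 0)).
      rewrite Zi in *; rewrite E0 in K; exact K. }
    assert (D2 := is_derive_inner_line g _ Ci 0 _ _ (Dg _ (Ri 0)) Dc).
    assert (D3 := is_derive_scal _ 0 2 _ D2); cbv beta in D3.
    apply (second_derivative_test _ _ _ D1) in D3.
    + rewrite Zi, g0, g10 in D3.
      rewrite <- Re_conj_mult_self.
      revert D3; generalize (z0 * G1 z0)%C (G z0).
      replace (z0 * (z0 * G2 z0))%C with (z0 ^ 2 * G2 z0)%C by (simpl; ring).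
      generalize (z0 ^ 2 * G2 z0)%C; intros a b c.
      unfold scal, Re, Im, Cconj; simpl; unfold mult; simpl; lra.
    + intros x; rewrite Zi; apply Hsq, Ri.
Qed.

(** * The third-order differential inequality *)

Lemma increment_on_disk (p p1 : C -> C) (r M : R) :
  (forall z, Cmod z <= r -> Cdiff p z (p1 z)) ->
  (forall z, Cmod z <= r -> Cmod (p1 z) <= M) ->
  forall z, Cmod z <= r -> Cmod (p z - p 0) <= Cmod z * M.
Proof.
  intros Dp HM z Hz.
  assert (Hseg : forall t, 0 <= t <= 1 -> Cmod (t * z) <= r).
  { intros t Ht; rewrite Cmod_mult, Cmod_R, Rabs_pos_eq by lra.
    assert (H0 := Cmod_ge_0 z); nra. }
  apply (mean_value_inequality p p1); intros t Ht; specialize (Hseg t Ht);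
    [apply Dp | apply HM]; exact Hseg.
Qed.

(** Let [a] be a maximum point of [|p1|] on a closed disk, with maximum [M], and
    let [S] be the combination with [z * S z] equal to the derivative terms of
    the operator.  The conditions at [a] give
    [Re (Cconj (p1 a) * S a) >= (g1 - g3 / 4) * M^2], while the hypothesis and
    [|p z - 1| <= M * |z|] give [|S a| <= 2 + M].  Hence [9 M <= 2 + M]. *)
Lemma gradient_bound (g1 g2 g3 : R) (p p1 p2 p3 : C -> C) :
  0 <= g2 -> 0 <= g3 -> 9 <= g1 - g3 / 4 ->
  (forall z, Cmod z < 1 -> Cdiff p z (p1 z)) ->
  (forall z, Cmod z < 1 -> Cdiff p1 z (p2 z)) ->
  (forall z, Cmod z < 1 -> Cdiff p2 z (p3 z)) ->
  Ccont p3 0 -> p 0 = 1 ->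
  (forall z, Cmod z < 1 ->
     Cmod (p z + g1 * z * p1 z + g2 * z ^ 2 * p2 z + g3 * z ^ 3 * p3 z - 1)
     <= 2 * Cmod z) ->
  forall z, Cmod z < 1 -> Cmod (p1 z) <= 1 / 4.
Proof.
  intros Hg2 Hg3 Hg Dp Dp1 Dp2 Cp3 p0 Hb z Hz; assert (Hz0 := Cmod_ge_0 z).
  set (r := (1 + Cmod z) / 2).
  assert (Hr : Cmod z < r < 1) by (unfold r; lra).
  destruct (Cmod_max_on_disk p1 r) as [a [Ha Hmax]]; [lra | |].
  { intros w Hw; eapply Cdiff_Ccont, Dp1; lra. }
  set (M := Cmod (p1 a)).
  assert (HM0 : 0 <= M) by apply Cmod_ge_0.
  assert (Hinc := increment_on_disk p p1 r M ltac:(intros w Hw; apply Dp; lra) Hmax).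
  rewrite p0 in Hinc.
  (* [S] is the derivative part of the operator divided by [z] *)
  set (S := fun w => (g1 * p1 w + w * (g2 * p2 w + g3 * (w * p3 w)))%C).
  assert (HS : forall w : C, w <> 0 -> Cmod w <= r -> Cmod (S w) <= 2 + M).
  { intros w Nw Hw; apply Cmod_gt_0 in Nw.
    apply Rmult_le_reg_l with (Cmod w); [exact Nw |].
    rewrite <- Cmod_mult.
    replace (w * S w)%C with
      ((p w + g1 * w * p1 w + g2 * w ^ 2 * p2 w + g3 * w ^ 3 * p3 w - 1) - (p w - 1))%C
      by (unfold S; simpl; ring).
    unfold Cminus at 1; eapply Rle_trans; [apply Cmod_triangle |]; rewrite Cmod_opp.
    specialize (Hb w ltac:(lra)); specialize (Hinc w Hw); lra. }
  assert (HSa : Cmod (S a) <= 2 + M).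
  { destruct (excluded_middle_informative (a = 0)) as [E | N]; [| apply HS; auto].
    (* at the centre the bound is the limit of the bounds nearby *)
    rewrite E.
    assert (I0 : Cmod 0 < 1) by (rewrite Cmod_0; lra).
    assert (CS : Ccont S 0).
    { apply (Ccont_plus (fun w => g1 * p1 w)%C).
      - apply Ccont_scal; eapply Cdiff_Ccont, Dp1, I0.
      - apply (Ccont_mult (fun w => w)); [eapply Cdiff_Ccont, Cdiff_id |].
        apply (Ccont_plus (fun w => g2 * p2 w)%C).
        + apply Ccont_scal; eapply Cdiff_Ccont, Dp2, I0.
        + apply (Ccont_scal _ (fun w => w * p3 w)%C).
          apply (Ccont_mult (fun w => w)); [eapply Cdiff_Ccont, Cdiff_id | exact Cp3]. }
    apply le_epsilon; intros eps He.
    destruct (proj1 (Ccont_eps _ _) CS eps He) as [d [Hd H]].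
    set (x := Rmin (d / 2) r).
    assert (X1 := Rmin_l (d / 2) r); assert (X2 := Rmin_r (d / 2) r); fold x in X1, X2.
    assert (X0 : 0 < x) by (apply Rmin_glb_lt; lra).
    assert (Hx : Cmod x = x) by (rewrite Cmod_R, Rabs_pos_eq; lra).
    specialize (H x); replace (x - 0)%C with (RtoC x) in H by ring.
    specialize (H ltac:(lra)); rewrite Cmod_minus_sym in H.
    specialize (HS x ltac:(apply Cmod_gt_0; lra) ltac:(lra)).
    assert (T := Cmod_minus_ge (S 0) (S x)); lra. }
  destruct (max_modulus_conditions p1 p2 p3 1 r a) as [Rad Tan]; auto; [lra |].
  apply Rle_trans with M; [apply Hmax; lra |].
  set (c := Cconj (p1 a)) in *.
  set (th := (a * p2 a)%C) in *.
  assert (Hc : Cmod c = M) by apply Cmod_conj.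
  assert (Hth : Re (c * th)%C <= M * Cmod th).
  { eapply Rle_trans; [apply Rle_abs |]; eapply Rle_trans; [apply re_le_Cmod |].
    rewrite Cmod_mult, Hc; lra. }
  assert (Hup : Re (c * S a)%C <= M * (2 + M)).
  { eapply Rle_trans; [apply Rle_abs |]; eapply Rle_trans; [apply re_le_Cmod |].
    rewrite Cmod_mult, Hc; apply Rmult_le_compat_l; lra. }
  assert (Hexp : Re (c * S a)%C = g1 * (M * M) + g2 * Re (c * th)%C
    + g3 * (Re (c * (th + a ^ 2 * p3 a))%C - Re (c * th)%C)).
  { replace (M * M) with (Re (c * p1 a)%C)
      by (unfold c; rewrite Re_conj_mult_self; fold M; ring).
    unfold S, th; generalize c (p1 a) (p2 a) (p3 a).
    intros; unfold Re; simpl; ring. }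
  (* minimise [x^2 - M x] over [x] *)
  assert (Hsq : - (M * M / 4) <= Cmod th ^ 2 - M * Cmod th).
  { assert (0 <= (Cmod th - M / 2) ^ 2) by apply pow2_ge_0; simpl in *; lra. }
  assert (0 <= g2 * Re (c * th)%C) by (apply Rmult_le_pos; lra).
  assert (g3 * - (M * M / 4) <= g3 * (Re (c * (th + a ^ 2 * p3 a))%C - Re (c * th)%C))
    by (apply Rmult_le_compat_l; lra).
  assert (9 * (M * M) <= (g1 - g3 / 4) * (M * M)) by (apply Rmult_le_compat_r; nra).
  nra.
Qed.

(** * The logarithm on the right half-plane *)

Definition Clog (z : C) : C := (ln (Cmod z), atan (Im z / Re z)).

Lemma Cexp_Clog (z : C) : 0 < Re z -> Cexp (Clog z) = z.
Proof.
  intros Hz; assert (H := Cmod2_alt z); assert (H0 := Cmod_ge_0 z).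
  assert (Hpos : 0 < Cmod z) by (assert (T := re_le_Cmod z); apply Rabs_le_between in T; lra).
  unfold Cexp, Clog; simpl; rewrite exp_ln, cos_atan, sin_atan by exact Hpos.
  set (t := Im z / Re z).
  assert (E : Cmod z = Re z * sqrt (1 + t * t)).
  { apply Rsqr_inj; [exact H0 | apply Rmult_le_pos; [lra | apply sqrt_pos] |].
    unfold Rsqr.
    replace (Re z * sqrt (1 + t * t) * (Re z * sqrt (1 + t * t)))
      with (Re z * Re z * (sqrt (1 + t * t) * sqrt (1 + t * t))) by ring.
    rewrite sqrt_sqrt by nra.
    unfold t; replace (Re z * Re z * (1 + Im z / Re z * (Im z / Re z)))
      with (Re z ^ 2 + Im z ^ 2) by (field; lra); rewrite <- H; ring. }
  assert (Hs : 0 < sqrt (1 + t * t)) by (apply sqrt_lt_R0; nra).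
  rewrite E; unfold Rsqr.
  apply injective_projections; simpl; [unfold Re; field; lra |].
  unfold t, Re, Im in *; field; split; lra.
Qed.

Lemma Ccont_of_2d (f : C -> C) (z : C) :
  continuity_2d_pt (fun x y => Re (f (x, y))) (Re z) (Im z) ->
  continuity_2d_pt (fun x y => Im (f (x, y))) (Re z) (Im z) -> Ccont f z.
Proof.
  intros H1 H2; apply Ccont_eps; intros eps He.
  assert (He2 : 0 < eps / 2) by lra.
  destruct (H1 (mkposreal _ He2)) as [d1 D1]; destruct (H2 (mkposreal _ He2)) as [d2 D2].
  exists (Rmin d1 d2); split; [apply Rmin_glb_lt; apply cond_pos |].
  intros w Hw; apply Rmin_Rgt_l in Hw as [W1 W2].
  assert (B1 := re_le_Cmod (w - z)); assert (B2 := im_le_Cmod (w - z)).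
  destruct w as [x y]; destruct z as [u v]; simpl in *.
  specialize (D1 x y); specialize (D2 x y).
  eapply Rle_lt_trans; [apply Cmod_le_Re_Im |]; simpl in *; unfold Re, Im, Rminus in *.
  specialize (D1 ltac:(lra) ltac:(lra)); specialize (D2 ltac:(lra) ltac:(lra)); lra.
Qed.

Lemma Ccont_Clog (z : C) : 0 < Re z -> Ccont Clog z.
Proof.
  intros Hz; destruct z as [x y]; simpl in Hz.
  assert (I1 := continuity_2d_pt_id1 x y); assert (I2 := continuity_2d_pt_id2 x y).
  apply Ccont_of_2d; simpl.
  - unfold Cmod; simpl.
    apply (continuity_1d_2d_pt_comp ln (fun u v => sqrt (u * (u * 1) + v * (v * 1)))).
    + apply derivable_continuous_pt; eexists; apply derivable_pt_lim_ln, sqrt_lt_R0; nra.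
    + apply (continuity_1d_2d_pt_comp sqrt (fun u v => u * (u * 1) + v * (v * 1))).
      * apply continuity_pt_sqrt; nra.
      * apply continuity_2d_pt_plus; repeat apply continuity_2d_pt_mult;
          auto; apply continuity_2d_pt_const.
  - apply (continuity_1d_2d_pt_comp atan (fun u v => v * / u)).
    + apply derivable_continuous_pt, derivable_pt_atan.
    + apply continuity_2d_pt_mult; [exact I2 |].
      apply continuity_2d_pt_inv; [exact I1 | lra].
Qed.

(** Derivative of a continuous right inverse of [Cexp]: put
    [h = Clog w - Clog z]; then [w - z = z * (Cexp h - 1)], and
    [Cexp h - 1 - h = o(h)]. *)
Lemma Cdiff_Clog (z : C) : 0 < Re z -> Cdiff Clog z (/ z)%C.
Proof.
  intros Hz.
  assert (Hre := re_le_Cmod z); apply Rabs_le_between in Hre.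
  assert (N : z <> 0) by (apply Cmod_gt_0; lra).
  assert (Hm : 0 < Cmod z) by lra.
  apply Cdiff_eps; intros eps He.
  set (e := Rmin (1 / 2) (eps * Cmod z / 2)).
  assert (E1 := Rmin_l (1 / 2) (eps * Cmod z / 2)).
  assert (E2 := Rmin_r (1 / 2) (eps * Cmod z / 2)); fold e in E1, E2.
  assert (He' : 0 < e)
    by (apply Rmin_glb_lt; [lra | apply Rdiv_lt_0_compat; [apply Rmult_lt_0_compat |]; lra]).
  destruct (proj1 (Cdiff_eps _ _ _) Cdiff_Cexp_0 e He') as [d1 [Hd1 H1]].
  destruct (proj1 (Ccont_eps _ _) (Ccont_Clog z Hz) d1 Hd1) as [d2 [Hd2 H2]].
  exists (Rmin d2 (Re z)); split; [apply Rmin_glb_lt; lra |].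
  intros w Hw; apply Rmin_Rgt_l in Hw as [W1 W2].
  assert (Hrw : 0 < Re w).
  { assert (T := re_le_Cmod (w - z)); apply Rabs_le_between in T.
    unfold Re in *; simpl in *; lra. }
  specialize (H2 w W1); set (h := (Clog w - Clog z)%C) in *.
  assert (Eh : (w - z)%C = (z * (Cexp h - 1))%C).
  { rewrite <- (Cexp_Clog w) at 1 by exact Hrw.
    replace (Clog w) with (Clog z + h)%C by (unfold h; ring).
    rewrite Cexp_plus, Cexp_Clog by exact Hz; ring. }
  specialize (H1 h); replace (h - 0)%C with h in H1 by ring; specialize (H1 H2).
  rewrite Cexp_0 in H1.
  set (rho := (Cexp h - 1 - 1 * h)%C) in *.
  replace (h - / z * (w - z))%C with (- rho)%C
    by (rewrite Eh; unfold rho; field; exact N).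
  rewrite Cmod_opp.
  assert (Hh : Cmod z * Cmod h <= 2 * Cmod (w - z)).
  { rewrite Eh, Cmod_mult.
    assert (T := Cmod_triangle (Cexp h - 1) (- rho)).
    replace (Cexp h - 1 + - rho)%C with h in T by (unfold rho; ring).
    rewrite Cmod_opp in T; assert (H0 := Cmod_ge_0 h).
    assert (Cmod h <= 2 * Cmod (Cexp h - 1)) by nra.
    nra. }
  assert (H0 := Cmod_ge_0 h).
  apply Rle_trans with (eps * Cmod z / 2 * Cmod h); [nra |].
  replace (eps * Cmod z / 2 * Cmod h) with (eps / 2 * (Cmod z * Cmod h)) by field.
  nra.
Qed.

Lemma ln_le_minus_1 (x : R) : 0 < x -> ln x <= x - 1.
Proof. intros Hx; assert (T := exp_ineq1_le (ln x)); rewrite exp_ln in T; lra. Qed.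

Lemma atan_le_abs (t : R) : Rabs (atan t) <= Rabs t.
Proof.
  assert (P : forall t, 0 < t -> 0 <= atan t <= t).
  { intros s Hs; destruct (MVT_cor2 atan (fun x => / (1 + x ^ 2)) 0 s Hs) as [c [E Hc]].
    - intros c _; apply is_derive_Reals; auto_derive; [auto | field; nra].
    - rewrite atan_0 in E.
      assert (I : 0 < / (1 + c ^ 2) <= 1).
      { assert (0 <= c ^ 2) by apply pow2_ge_0; split; [apply Rinv_0_lt_compat; lra |].
        rewrite <- Rinv_1; apply Rinv_le_contravar; lra. }
      nra. }
  destruct (Rtotal_order t 0) as [H | [-> | H]].
  - specialize (P (- t) ltac:(lra)); rewrite atan_opp in P; rewrite !Rabs_left1; lra.
  - rewrite atan_0; lra.
  - specialize (P t H); rewrite !Rabs_pos_eq; lra.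
Qed.

(** Both the logarithm of the modulus and the argument are at most
    [(4 / 3) * |z - 1|], because [Re z] and [Cmod z] are at least [3 / 4]. *)
Lemma Cmod_Clog_le (z : C) : Cmod (z - 1) <= 1 / 4 -> Cmod (Clog z) <= 3 * Cmod (z - 1).
Proof.
  intros Hu; set (u := Cmod (z - 1)) in *.
  assert (U0 : 0 <= u) by apply Cmod_ge_0.
  assert (B1 := re_le_Cmod (z - 1)); assert (B2 := im_le_Cmod (z - 1)); fold u in B1, B2.
  assert (Hre : 3 / 4 <= Re z)
    by (apply Rabs_le_between in B1; unfold Re in *; simpl in *; lra).
  assert (Him : Rabs (Im z) <= u)
    by (unfold Im in *; simpl in B2; replace (snd z + - 0) with (snd z) in B2 by ring; exact B2).
  assert (T1 := Cmod_minus_ge z 1); assert (T2 := Cmod_minus_ge 1 z).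
  rewrite (Cmod_minus_sym 1 z) in T2; fold u in T1, T2; rewrite Cmod_1 in T1, T2.
  set (m := Cmod z) in *.
  eapply Rle_trans; [apply Cmod_le_Re_Im |]; unfold Clog; simpl; fold m.
  assert (A : Rabs (atan (Im z / Re z)) <= 4 / 3 * u).
  { eapply Rle_trans; [apply atan_le_abs |].
    unfold Rdiv; rewrite Rabs_mult, (Rabs_pos_eq (/ Re z))
      by (apply Rlt_le, Rinv_0_lt_compat; lra).
    assert (I : / Re z <= 4 / 3).
    { replace (4 / 3) with (/ (3 / 4)) by field; apply Rinv_le_contravar; lra. }
    assert (0 < / Re z) by (apply Rinv_0_lt_compat; lra).
    rewrite (Rmult_comm (4 * / 3)); apply Rmult_le_compat; try lra; apply Rabs_pos. }
  assert (L : Rabs (ln m) <= 4 / 3 * u).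
  { assert (L1 := ln_le_minus_1 m ltac:(lra)).
    assert (Im : 0 < / m) by (apply Rinv_0_lt_compat; lra).
    assert (L2 := ln_le_minus_1 (/ m) Im); rewrite ln_Rinv in L2 by lra.
    assert (Hi : / m * m = 1) by (field; lra).
    assert (/ m - 1 <= 4 / 3 * u) by nra.
    apply Rabs_le_between; lra. }
  lra.
Qed.

Lemma Clog_1 : Clog 1 = 0.
Proof.
  unfold Clog; rewrite Cmod_1, ln_1; simpl.
  replace (0 / 1) with 0 by field; rewrite atan_0; reflexivity.
Qed.

(** * The subordination *)

(** For [s] with [s^2 = 1 + w^2] and nonnegative real part, [|s + 1| >= 1], so
    [|s - 1| <= |s - 1| * |s + 1| = |w|^2]. *)
Lemma crescent_minus_1 (w : C) : Cmod w <= 1 ->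
  Cmod (w + Csqrt (1 + w ^ 2) - 1) <= 2 * Cmod w.
Proof.
  intros Hw; set (s := Csqrt (1 + w ^ 2)).
  assert (Hs : (s * s)%C = (1 + w ^ 2)%C) by apply Csqrt_sqr.
  assert (Hre : 0 <= Re s) by apply Csqrt_Re_ge_0.
  assert (H1 : 1 <= Cmod (s + 1)).
  { assert (T := re_le_Cmod (s + 1)); apply Rabs_le_between in T.
    rewrite re_plus, re_RtoC in T; lra. }
  assert (H2 : Cmod (s - 1) * Cmod (s + 1) = Cmod w * Cmod w).
  { rewrite <- !Cmod_mult; f_equal.
    replace ((s - 1) * (s + 1))%C with (s * s - 1)%C by ring; rewrite Hs; simpl; ring. }
  assert (T := Cmod_triangle w (s - 1)).
  replace (w + (s - 1))%C with (w + s - 1)%C in T by ring.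
  assert (P1 := Cmod_ge_0 w); assert (P2 := Cmod_ge_0 (s - 1)).
  nra.
Qed.

Lemma exp_1_ge : 9 / 4 <= exp 1.
Proof.
  assert (T := exp_ineq1_le (1 / 2)).
  replace 1 with (1 / 2 + 1 / 2) by field; rewrite exp_plus; nra.
Qed.

Lemma analytic_Cdiff (f : C -> C) : analytic_on unit_disk f ->
  forall z, Cmod z < 1 -> Cdiff f z (C_derive f z).
Proof.
  intros Hf z Hz; apply is_derive_Cdiff, C_derive_correct; [exact z | apply Hf, Hz].
Qed.

Lemma analytic_C_derive (f : C -> C) : analytic_on unit_disk f ->
  analytic_on unit_disk (C_derive f).
Proof.
  intros Hf z Hz.
  destruct (Cdiff_derivative_again f _ 1 (analytic_Cdiff f Hf) z Hz) as [l Hl].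
  exists l; apply is_derive_Cdiff, Hl.
Qed.

Theorem theorem4p3 (m k gamma1 gamma2 gamma3 : R) (p : C -> C)
  (hm : 2 <= m) (hk : m <= k)
  (hg1 : 0 < gamma1) (hg2 : 0 < gamma2) (hg3 : 0 < gamma3)
  (hcond :
     gamma1 - gamma2 - m ^ 2 * gamma3 - 3 * m * (k - 1) * gamma3
       - exp 1 * (exp 1 + 1) >= sqrt 2 * exp 1
     \/
     1 - exp 1 - exp 1 * (gamma1 + gamma2 + m ^ 2 * gamma3
       + 3 * m * (k - 1) * gamma3) >= sqrt 2)
  (hp : analytic_on unit_disk p)
  (hp0 : p (RtoC 0) = RtoC 1)
  (hsub : subordinate
     (fun z : C => p z + RtoC gamma1 * z * C_derive p z
        + RtoC gamma2 * z ^ 2 * C_derive (C_derive p) z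
        + RtoC gamma3 * z ^ 3 * C_derive (C_derive (C_derive p)) z)%C
     (fun z : C => z + Csqrt (RtoC 1 + z ^ 2))%C) :
  subordinate p Cexp.
Proof.
  assert (He := exp_1_ge).
  assert (Hs2 : 7 / 5 <= sqrt 2).
  { rewrite <- (sqrt_pow2 (7 / 5)) by lra; apply sqrt_le_1_alt; lra. }
  assert (Hmg : 0 <= m ^ 2 * gamma3) by (apply Rmult_le_pos; [apply pow2_ge_0 | lra]).
  assert (Hmk : 2 <= m * (k - 1)) by nra.
  assert (Hkg : 6 * gamma3 <= 3 * m * (k - 1) * gamma3) by nra.
  assert (Hg : 9 <= gamma1 - gamma3 / 4).
  { destruct hcond as [H | H]; [nra |].
    (* the second alternative is contradictory: its left side is negative *)
    assert (0 <= exp 1 * (gamma1 + gamma2 + m ^ 2 * gamma3 + 3 * m * (k - 1) * gamma3))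
      by (apply Rmult_le_pos; lra).
    lra. }
  assert (hp1 := analytic_C_derive _ hp).
  assert (hp2 := analytic_C_derive _ hp1).
  assert (hp3 := analytic_C_derive _ hp2).
  assert (Dp := analytic_Cdiff _ hp).
  assert (Hgrad : forall z, Cmod z < 1 -> Cmod (C_derive p z) <= 1 / 4).
  { apply (gradient_bound gamma1 gamma2 gamma3 p _ _ _ ltac:(lra) ltac:(lra) Hg Dp
      (analytic_Cdiff _ hp1) (analytic_Cdiff _ hp2)).
    - eapply Cdiff_Ccont, (analytic_Cdiff _ hp3); rewrite Cmod_0; lra.
    - exact hp0.
    - intros z Hz; destruct hsub as [w [_ [Hw1 [_ [Hw2 Hw3]]]]].
      rewrite (Hw3 z Hz).
      specialize (Hw1 z Hz); specialize (Hw2 z Hz); unfold unit_disk in Hw1.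
      eapply Rle_trans; [apply crescent_minus_1; lra | lra]. }
  assert (Hinc : forall z, Cmod z < 1 -> Cmod (p z - 1) <= Cmod z / 4).
  { intros z Hz; rewrite <- hp0.
    replace (Cmod z / 4) with (Cmod z * (1 / 4)) by field.
    apply (increment_on_disk p (C_derive p) (Cmod z)); [| | lra]; intros w Hw;
      [apply Dp | apply Hgrad]; lra. }
  assert (Hre : forall z, Cmod z < 1 -> 0 < Re (p z)).
  { intros z Hz; specialize (Hinc z Hz).
    assert (T := re_le_Cmod (p z - 1)); apply Rabs_le_between in T.
    unfold Re in *; simpl in *; lra. }
  assert (Hlog : forall z, Cmod z < 1 -> Cmod (Clog (p z)) <= Cmod z).
  { intros z Hz; specialize (Hinc z Hz); assert (H0 := Cmod_ge_0 z).
    eapply Rle_trans; [apply Cmod_Clog_le |]; lra. }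
  exists (fun z => Clog (p z)); repeat split.
  - intros z Hz; eexists; apply is_derive_Cdiff.
    apply (Cdiff_comp Clog p); [apply Cdiff_Clog, Hre, Hz | apply Dp, Hz].
  - intros z Hz; unfold unit_disk in *; specialize (Hlog z Hz); lra.
  - rewrite hp0; apply Clog_1.
  - exact Hlog.
  - intros z Hz; symmetry; apply Cexp_Clog, Hre, Hz.
Qed.
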